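(* Let $1\le p,p_1,\dots,p_m<\infty$ with $\frac1p=\frac1{p_1}+\cdots+\frac1{p_m}$, let $X_1,\dots,X_m,Y$ be Banach spaces and let $\Phi_j:\widehat X_j\to C(B_{X_j^*})$, $j=1,\dots,m$, be bounded homogeneous maps. An operator $T\in\mathcal L(X_1,\dots,X_m;Y)$ is $(\Phi_1,\dots,\Phi_m)$-abstract $(p_1,\dots,p_m)$-summing if and only if there are a constant $C>0$ and regular Borel probability measures $\mu_j\in C(B_{X_j^*})^*$ on $B_{X_j^*}$ ($j=1,\dots,m$) such that for all $x^j\in X_j$ ($j=1,\dots,m$), $$\|T(x^1,\dots,x^m)\|\le C\prod_{j=1}^m\Big(\int_{B_{X_j^*}}|\Phi_j(\langle x^j,\cdot\rangle)|^{p_j}\,d\mu_j\Big)^{1/p_j}.$$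
   Context: $\mathcal L(X_1,\dots,X_m;Y)$ is the space of continuous $m$-linear mappings $X_1\times\cdots\times X_m\to Y$. $B_{X_j^*}$ is the closed unit ball of $X_j^*$ with the weak* topology (compact Hausdorff), $C(B_{X_j^*})$ the space of continuous functions on it with the supremum norm. For $x\in X_j$, $\langle x,\cdot\rangle\in C(B_{X_j^*})$ is $x^*\mapsto\langle x,x^*\rangle$, and $\widehat X_j=\{\langle x,\cdot\rangle:x\in X_j\}\subset C(B_{X_j^*})$. A (not necessarily linear) map $\Phi$ is homogeneous if $\Phi(\lambda v)=\lambda\Phi(v)$ for all real $\lambda>0$ and all $v$, and bounded if there is a constant $K$ with $\|\Phi(v)\|\le K\|v\|$ for all $v$. $T$ is $(\Phi_1,\dots,\Phi_m)$-abstract $(p_1,\dots,p_m)$-summing if there is $C>0$ such that for all $n\in\mathbb N$ and $x_1^j,\dots,x_n^j\in X_j$ ($1\le j\le m$), $$\Big(\sum_{i=1}^n\|T(x_i^1,\dots,x_i^m)\|^p\Big)^{1/p}\le C\prod_{j=1}^m\Big\|\Big(\sum_{i=1}^n|\Phi_j(\langle x_i^j,\cdot\rangle)|^{p_j}\Big)^{1/p_j}\Big\|_{C(B_{X_j^*})}.$$ *)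

(* Defs.v *)
From HB Require Import structures.
From mathcomp Require Import all_boot all_order all_algebra.
From mathcomp Require Import complex.
From mathcomp Require Import all_classical all_reals all_analysis.

Set Implicit Arguments.
Unset Strict Implicit.
Unset Printing Implicit Defensive.

Import Order.TTheory GRing.Theory Num.Theory.
Import numFieldNormedType.Exports.

Local Open Scope classical_set_scope.
Local Open Scope ring_scope.

(* Banach spaces are real or complex: [scalar_field R K] says that [K] is [R]
   or [R[i]].  The norm of a [normedModType K] takes its values in [K]; [sre]
   (the real part) brings them back to [R]. *)
Variant scalar_field (R : realType) : numFieldType -> Type :=
  | RealScalars : scalar_field R R
  | ComplexScalars : scalar_field R (complex R).

Definition sre (R : realType) (K : numFieldType) (s : scalar_field R K) :
    K -> R :=
  match s in scalar_field _ K' return K' -> R with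
  | RealScalars => fun z => z
  | ComplexScalars => fun z => complex.Re z
  end.

Definition sinj (R : realType) (K : numFieldType) (s : scalar_field R K) :
    R -> K :=
  match s in scalar_field _ K' return R -> K' with
  | RealScalars => fun r => r
  | ComplexScalars => fun r => Complex r 0
  end.

Definition rnorm (R : realType) (K : numFieldType) (s : scalar_field R K)
  (V : normedModType K) (v : V) : R := sre s `|v|.

Lemma rnorm0 (R : realType) (K : numFieldType) (s : scalar_field R K)
  (V : normedModType K) : rnorm s (0 : V) = 0.
Proof. by rewrite /rnorm normr0; case: s V. Qed.

Definition sup_norm (R : realType) (B : Type) (g : B -> R) : R :=
  sup (range (fun b => `|g b|)).

Section dual_ball.
Context (R : realType) (K : numFieldType) (s : scalar_field R K).
Variable X : normedModType K.

Definition functional_norm (f : X -> K) : R :=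
  sup [set rnorm s (f x) | x in [set x : X | rnorm s x <= 1]].

(* The weak* topology is that of pointwise convergence, i.e. the one of
   [{ptws X -> K}]; [wball] carries the induced topology. *)
Definition dual_ball : set {ptws X -> K} :=
  [set f : X -> K | [/\ linear (f : X -> K^o), continuous f
                      & functional_norm f <= 1]].

Definition wball : Type := dual_ball.

HB.instance Definition _ := Topological.copy wball (set_type dual_ball).

Lemma zero_in_dual_ball : dual_ball (fun=> 0).
Proof.
split; first by move=> a x y; rewrite scaler0 addr0.
  by move=> x; exact: cvg_cst.
rewrite /functional_norm (_ : [set _ | _ in _] = [set 0]) ?sup1 ?ler01//.
apply/seteqP; split=> [_ [x _ <-]|_ ->]; first by rewrite /= rnorm0.
by exists 0; rewrite /= rnorm0// ler01.
Qed.

(* [g_sigma_algebraType] requires a pointed type. *)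
HB.instance Definition _ :=
  isPointed.Build wball (SigSub (mem_set zero_in_dual_ball)).

Definition eval_at (x : X) (f : wball) : K := (set_val f : X -> K) x.

Lemma eval_at_continuous (x : X) : continuous (eval_at x).
Proof.
move=> f.
apply: (@continuous_comp _ _ _ (set_val : wball -> {ptws X -> K})
  (fun h : {ptws X -> K} => h x)).
  exact: initial_continuous.
exact: (@proj_continuous X (fun=> K) x).
Qed.

Definition CB : Type := continuousType wball K.

Definition CB_norm (g : CB) : R := sup_norm (fun b => rnorm s (g b : K^o)).

Definition bracket (x : X) : CB :=
  (mkcts (@eval_at_continuous x) : continuousType wball K).

Definition Xhat : set CB := range bracket.

Definition hat (x : X) : Xhat := SigSub (mem_set (imageT bracket x)).

Definition homogeneous (Phi : Xhat -> CB) : Prop :=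
  forall (lambda : R) (u v : Xhat), 0 < lambda ->
    (forall b, (set_val u : CB) b = sinj s lambda * (set_val v : CB) b) ->
    forall b, Phi u b = sinj s lambda * Phi v b.

Definition bounded_map (Phi : Xhat -> CB) : Prop :=
  exists M : R, forall v : Xhat, CB_norm (Phi v) <= M * CB_norm (set_val v).

Definition borel_wball := g_sigma_algebraType (@open wball).

Definition regular_measure (mu : {measure set borel_wball -> \bar R}) : Prop :=
  forall A : set borel_wball, measurable A ->
    mu A = ereal_inf [set mu U | U in [set U : set wball | open U /\ A `<=` U]]
    /\ mu A =
       ereal_sup [set mu F | F in [set F : set wball | compact F /\ F `<=` A]].

End dual_ball.
Arguments Xhat {R K} s X.
Arguments hat {R K} s {X} x.

Section summing.
Context (R : realType) (K : numFieldType) (s : scalar_field R K) (m : nat).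
Variables (X : 'I_m -> normedModType K) (Y : normedModType K).

Definition multilinear (T : (forall j, X j) -> Y) : Prop :=
  forall (x : forall j, X j) (j : 'I_m), linear (fun v : X j => T (dfwith x j v)).

Definition continuous_multilinear (T : (forall j, X j) -> Y) : Prop :=
  multilinear T /\ continuous (T : prod_topology X -> Y).

Definition abstract_summing (Phi : forall j, Xhat s (X j) -> CB s (X j))
    (p : R) (q : 'I_m -> R) (T : (forall j, X j) -> Y) : Prop :=
  exists2 C : R, 0 < C &
    forall (n : nat) (x : 'I_n -> forall j, X j),
      (\sum_(i < n) rnorm s (T (x i)) `^ p) `^ p^-1 <=
      C * \prod_(j < m) sup_norm (fun b : wball s (X j) =>
        (\sum_(i < n) rnorm s (Phi j (hat s (x i j)) b : K^o) `^ q j)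
          `^ (q j)^-1).

End summing.

(* Main.v *)
(* Write [w_j = p / q_j], so that [sum_j w_j = 1].  If [mu_j] dominates [T],
   Hoelder's inequality with exponents [1 / w_j] gives the summing inequality.
   Conversely, the weighted AM-GM inequality turns the summing inequality into
     [sum_i |T x_i|^p <= C^p sum_j w_j sup_b sum_i |Phi_j x_i^j (b)|^q_j],
   so no element of the convex cone generated by the tuples of functions
   [(w_j (C^p |Phi_j x^j|^q_j - |T x|^p))_j] has a negative sum of suprema.
   Hahn-Banach yields normalized positive functionals [L_j] whose sum is
   nonnegative on this cone, Riesz-Markov on the weak* compact balls represents
   them by regular probability measures, and
     [|T x|^p <= C^p sum_j w_j int |Phi_j x^j|^q_j dmu_j].
   Rescaling each [x^j] so that its integral becomes 1 turns the weighted sum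
   back into a product. *)
Require Import Defs.
From HB Require Import structures.
From mathcomp Require Import all_boot all_order all_algebra.
From mathcomp Require Import complex.
From mathcomp Require Import all_classical all_reals all_analysis.
From mathcomp Require Import finmap measurable_realfun ring lra.

Set Implicit Arguments.
Unset Strict Implicit.
Unset Printing Implicit Defensive.

Import Order.TTheory GRing.Theory Num.Theory.
Import numFieldNormedType.Exports.

Local Open Scope classical_set_scope.
Local Open Scope ring_scope.

(** * The Hahn-Banach theorem *)

Section hahn_banach.
Context (R : realType) (V : lmodType R).
Implicit Types (p : V -> R) (x y : V).

(** The [m] measures must be found simultaneously, since the inequality couples them through a sum
    over [j]. So a tuple of functions is glued into one bounded function on the disjoint union of
    the balls, and a single Hahn-Banach functional there is cut into its restrictions to the
    summands. Its majorant, the infimum over [h] in the cone of [sum_j sup (f_j + h_j)], yields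
    nonnegativity on the cone and positivity and normalization of every restriction at once. The
    relation between the exponents enters twice. It makes the weights sum to 1, so that under
    normalized functionals the constants [w_j |T x|^p] add up to [|T x|^p]. It also makes the
    dilation of each [x^j] by [t^(1/q_j)] multiply both [|Phi_j x^j|^q_j] and [|T x|^p] by [t], so
    that finite sequences without coefficients already form a cone. In the final rescaling an
    integral may vanish; it is replaced by a larger positive number that then decreases to it. [T]
    and [Phi_j] intervene only through nonnegative functions homogeneous under positive dilations,
    which treats real and complex scalars alike. *)

Definition sublinear p :=
  (forall x y, p (x + y) <= p x + p y) /\
  (forall (t : R) x, 0 < t -> p (t *: x) <= t * p x).

Lemma sublinear0 p : sublinear p -> p 0 = 0.
Proof.
move=> [_ pZ]; have := pZ 2 0 (ltr0n _ 2).
have := pZ 2^-1 0; rewrite invr_gt0 ltr0n => /(_ isT).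
rewrite !scaler0; lra.
Qed.

Lemma sublinearZ p (t : R) x : sublinear p -> 0 <= t -> p (t *: x) = t * p x.
Proof.
move=> sp; rewrite le_eqVlt => /predU1P[<-|t0].
  by rewrite scale0r mul0r sublinear0.
apply/eqP; rewrite eq_le sp.2//=.
have := sp.2 t^-1 (t *: x); rewrite invr_gt0 => /(_ t0).
by rewrite scalerA mulVf ?gt_eqF// scale1r ler_pdivlMl.
Qed.

Lemma sublinear_opp p x : sublinear p -> - p (- x) <= p x.
Proof.
by move=> sp; rewrite lerNl -subr_ge0 opprK -(sublinear0 sp) -(subrr x) addrC
  sp.1.
Qed.

(** Serves two families: the translates [p (x + t *: y) - t * p y], which are not individually
    homogeneous, and the chains of Zorn's lemma. Hence sublinearity is asked of the family as a
    whole, with a witness that may depend on the points. *)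
Lemma sublinear_inf (A : set (V -> R)) (b : V -> R) : A !=set0 ->
  (forall p x, A p -> b x <= p x) ->
  (forall p1 p2 x y, A p1 -> A p2 ->
    exists2 p, A p & p (x + y) <= p1 x + p2 y) ->
  (forall (t : R) p x, 0 < t -> A p ->
    exists2 p', A p' & p' (t *: x) <= t * p x) ->
  sublinear (fun x => inf [set p x | p in A]).
Proof.
move=> [p0 Ap0] bA AD AZ.
have infA x : has_inf [set p x | p in A].
  split; first by exists (p0 x), p0.
  by exists (b x) => _ [p Ap <-]; exact: bA.
have le x p : A p -> inf [set p x | p in A] <= p x.
  by move=> Ap; apply: ge_inf; [exact: (infA x).2|exists p].
split=> [x y|t x t0] /=.
  rewrite -lerBlDr; apply: (lb_le_inf (infA x).1).
  move=> _ [p Ap <-]; rewrite lerBlDr -lerBlDl.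
  apply: (lb_le_inf (infA y).1).
  move=> _ [q Aq <-]; rewrite lerBlDl.
  by have [r Ar] := AD p q x y Ap Aq; apply: le_trans; exact: le.
rewrite -ler_pdivrMl//; apply: (lb_le_inf (infA x).1).
move=> _ [p Ap <-]; rewrite ler_pdivrMl//.
by have [q Aq] := AZ t p x t0 Ap; apply: le_trans; exact: le.
Qed.

(* The infimum over [A] is a sublinear minorant of [p] whose value at [- y] is
   at most [- p y]. *)
Lemma minimal_sublinear_opp p y : sublinear p ->
  (forall q, sublinear q -> (forall x, q x <= p x) -> forall x, p x <= q x) ->
  p (- y) = - p y.
Proof.
move=> sp pmin.
pose A : set (V -> R) := [set q | exists2 t : R, 0 <= t &
  q = fun x => p (x + t *: y) - t * p y].
pose q x := inf [set r x | r in A].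
(* Subadditivity gives [t * p y = p (t *: y) <= p (x + t *: y) + p (- x)]. *)
have lbA r x : A r -> - p (- x) <= r x.
  move=> [t t0 ->]; rewrite lerBrDr addrC -(sublinearZ _ sp)// lerBlDr.
  by rewrite (le_trans _ (sp.1 _ _))// addrAC subrr add0r.
have Ap : A p.
  by exists 0 => //; apply/funext => x; rewrite scale0r addr0 mul0r subr0.
have sq : sublinear q.
  apply: (@sublinear_inf _ (fun x => - p (- x))).
  - by exists p.
  - by move=> r x; exact: lbA.
  - move=> _ _ x x' [s s0 ->] [t t0 ->].
    exists (fun x => p (x + (s + t) *: y) - (s + t) * p y).
      by exists (s + t) => //; exact: addr_ge0.
    rewrite [in (s + t) *: y]scalerDl addrACA;
      have := sp.1 (x + s *: y) (x' + t *: y); lra.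
  - move=> c _ x c0 [t t0 ->].
    exists (fun x => p (x + (c * t) *: y) - (c * t) * p y).
      by exists (c * t) => //; exact: mulr_ge0 (ltW c0) t0.
    by rewrite -scalerA -scalerDr mulrBr mulrA lerD2r sp.2.
have leq r x : A r -> q x <= r x.
  move=> Ar; apply: ge_inf; last by exists r.
  by exists (- p (- x)) => _ [r' Ar' <-]; exact: lbA.
apply/eqP; rewrite eq_le; apply/andP; split; last first.
  by rewrite lerNl sublinear_opp.
have /(_ (- y)) /le_trans := pmin q sq (fun x => leq p x Ap); apply.
(* The member [t = 1] takes the value [p 0 - p y = - p y] at [- y]. *)
have Ar : A (fun x => p (x + 1 *: y) - 1 * p y) by exists 1.
by rewrite (le_trans (leq _ _ Ar))//= scale1r addNr (sublinear0 sp) mul1r sub0r.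
Qed.

(* A minimal sublinear functional below [rho] is odd, hence linear. *)
Theorem hahn_banach (rho : V -> R) : sublinear rho ->
  exists2 L : V -> R, (forall (a : R) x y, L (a *: x + y) = a * L x + L y) &
    forall x, L x <= rho x.
Proof.
move=> srho.
pose T := {p | sublinear p /\ forall x, p x <= rho x}.
(* The order is reversed: a maximal element for [leT] is a minimal functional, and a nonempty chain
   is bounded by its pointwise infimum. Of two members of a chain, the smaller one witnesses
   subadditivity. *)
pose leT (p q : T) := `[< forall x, sval q x <= sval p x >].
have [] := @ZL_preorder T (exist _ rho (conj srho (fun x => lexx _))) leT.
- by move=> p; apply/asboolP.
- move=> p q r /asboolP pq /asboolP qr; apply/asboolP => x.
  exact: le_trans (qr x) (pq x).
- move=> A totA; have [[p0 Ap0]|A0] := pselect (A !=set0); last first.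
    by exists (exist _ rho (conj srho (fun x => lexx _))) => p Ap; case: A0;
      exists p.
  pose B : set (V -> R) := [set sval p | p in A].
  have lbB p x : B p -> - rho (- x) <= p x.
    move=> [[q [sq qr]] Aq <-]/=.
    by rewrite (le_trans _ (sublinear_opp x sq))// lerN2.
  have sB : sublinear (fun x => inf [set p x | p in B]).
    apply: (@sublinear_inf _ (fun x => - rho (- x))).
    + by exists (sval p0), p0.
    + by move=> p x; exact: lbB.
    + move=> _ _ x y [p Ap <-] [q Aq <-].
      have [/asboolP pq|/asboolP qp] := totA p q Ap Aq.
        exists (sval q); first by exists q.
        by rewrite (le_trans ((svalP q).1.1 _ _))// lerD2r.
      exists (sval p); first by exists p.
      by rewrite (le_trans ((svalP p).1.1 _ _))// lerD2l.
    + move=> t _ x t0 [p Ap <-]; exists (sval p); first by exists p.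
      exact: (svalP p).1.2.
  have leB (p : T) x : A p -> inf [set p x | p in B] <= sval p x.
    move=> Ap; apply: ge_inf; last by exists (sval p) => //; exists p.
    by exists (- rho (- x)) => _ [r' Ar' <-]; exact: lbB.
  have Brho x : inf [set p x | p in B] <= rho x.
    exact: le_trans (leB _ _ Ap0) ((svalP p0).2 x).
  pose good p := sublinear p /\ forall x, p x <= rho x.
  exists (exist good _ (conj sB Brho)) => p Ap; apply/asboolP => x /=.
  exact: leB.
move=> [p pP] pmax; have [sp prho] := pP; exists p => //.
have pN y : p (- y) = - p y.
  apply: minimal_sublinear_opp sp _ => q sq qp.
  have qrho x : q x <= rho x by exact: le_trans (prho x).
  pose good p := sublinear p /\ forall x, p x <= rho x.
  have := pmax (exist good q (conj sq qrho)).
  by move=> /(_ (introT (asboolP _) qp))/asboolP.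
have pD x y : p (x + y) = p x + p y.
  apply/eqP; rewrite eq_le sp.1/= -lerBrDr -pN.
  by rewrite (le_trans _ (sp.1 _ _))// addrK.
move=> a x y; rewrite pD; congr (_ + _).
have [a0|a0] := leP 0 a; first exact: sublinearZ.
rewrite -[a]opprK scaleNr pN mulNr; congr (- _).
by rewrite (sublinearZ _ sp)// oppr_ge0 ltW.
Qed.

End hahn_banach.

(** * Bounded functions on a disjoint union and separation of a cone *)

Section bounded_functions.
Context (R : realType) (Z : Type).

Definition bounded_real (f : Z -> R) := exists M : R, forall z, `|f z| <= M.

Definition bounded_pred : {pred Z -> R^o} := fun f => `[< bounded_real f >].

Lemma bounded_pred_submod : submod_closed bounded_pred.
Proof.
split; first by apply/asboolP; exists 0 => z; rewrite normr0.
move=> a f g /asboolP[M fM] /asboolP[N gN]; apply/asboolP.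
exists (`|a| * M + N) => z.
by rewrite (le_trans (ler_normD _ _))// lerD// normrM ler_wpM2l.
Qed.

HB.instance Definition _ :=
  GRing.isSubmodClosed.Build R (Z -> R^o) bounded_pred bounded_pred_submod.

Record bounded_function := BoundedFunction {
  bf_val :> Z -> R^o;
  bf_valP : bf_val \in bounded_pred }.

HB.instance Definition _ := [isSub for bf_val].
HB.instance Definition _ := gen_eqMixin bounded_function.
HB.instance Definition _ := gen_choiceMixin bounded_function.
HB.instance Definition _ := [SubChoice_isSubLmodule of bounded_function by <:].

End bounded_functions.

Lemma sup_range_le (R : realType) (B : Type) (b0 : B) (f : B -> R) (c : R) :
  (forall b, f b <= c) -> sup (range f) <= c.
Proof. by move=> fc; apply: ge_sup; [exists (f b0), b0|move=> _ [b _ <-]]. Qed.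

Lemma le_sup_range (R : realType) (B : Type) (f : B -> R) (M : R) (b : B) :
  (forall b, f b <= M) -> f b <= sup (range f).
Proof. by move=> fM; apply: ub_le_sup; [exists M => _ [b' _ <-]|exists b]. Qed.

Lemma bounded_real_lin (R : realType) (B : Type) (a : R) (f g : B -> R) :
  bounded_real f -> bounded_real g -> bounded_real (fun b => a * f b + g b).
Proof.
move=> /asboolP f_bd /asboolP g_bd.
by have /asboolP := (@bounded_pred_submod R B).2 a f g f_bd g_bd.
Qed.

(* Bounding [L f] by every upper bound of [f] encodes both positivity and
   [L 1 = 1]. *)
Definition mean_on (R : realType) (B : Type) (D : set (B -> R))
    (L : (B -> R) -> R) :=
  (forall (a : R) f g, D f -> D g ->
    L (fun b => a * f b + g b) = a * L f + L g) /\
  (forall f c, D f -> (forall b, f b <= c) -> L f <= c).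

Section cone_separation.
Context (R : realType) (I : finType) (B : I -> Type) (b0 : forall i, B i).
Implicit Types h g : forall i, B i -> R.
Variable S : set (forall i, B i -> R).
Hypothesis S_bounded : forall h, S h -> forall i, bounded_real (h i).
Hypothesis S0 : S (fun _ _ => 0).
Hypothesis SD : forall h g, S h -> S g -> S (fun i b => h i b + g i b).
Hypothesis SZ : forall (t : R) h, 0 < t -> S h -> S (fun i b => t * h i b).
Hypothesis S_sup : forall h, S h -> 0 <= \sum_i sup (range (h i)).

Let V : lmodType R := bounded_function R {i & B i}.

Let glue h : {i & B i} -> R := fun z => h (tag z) (tagged z).

Let bounded_glue h : (forall i, bounded_real (h i)) -> bounded_real (glue h).
Proof.
move=> /choice[M hM]; exists (\sum_i `|M i|) => -[i b]; rewrite /glue/=.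
rewrite (le_trans (hM i b))// (bigD1 i)//= (le_trans (ler_norm _))//.
by rewrite lerDl sumr_ge0.
Qed.

Let sum_sup h : R := \sum_i sup (range (h i)).

Let sum_sup_le h (c : I -> R) :
  (forall i b, h i b <= c i) -> sum_sup h <= \sum_i c i.
Proof. by move=> hc; apply: ler_sum => i _; exact/(sup_range_le (b0 i)). Qed.

Let part (f : V) : forall i, B i -> R := fun i b => bf_val f (Tagged B b).

Arguments part : clear implicits.

Let bounded_part f i : bounded_real (part f i).
Proof. by have /asboolP[M fM] := bf_valP f; exists M => b; exact: fM. Qed.

(* [rho (- h) <= 0] for [h] in [S], so a linear functional below [rho] is
   nonnegative on [S]; [S_sup] is what makes [rho] finite. *)
Let rho (f : V) : R :=
  inf [set sum_sup (fun i b => part f i b + h i b) | h in S].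

Let rho_le f h : S h -> rho f <= sum_sup (fun i b => part f i b + h i b).
Proof.
move=> Sh; apply: ge_inf; last by exists h.
have [M fM] : bounded_real (bf_val f) by apply/asboolP/bf_valP.
(* As [f >= - M], each [sup (f + g)] is at least [sup g - M], and the suprema of [g] have a
   nonnegative sum. *)
exists (\sum_(i : I) - M) => _ [g Sg <-].
rewrite -subr_ge0 (le_trans (S_sup Sg))// -sumrB.
apply: ler_sum => i _; apply: (sup_range_le (b0 i)) => b.
have [N gN] := S_bounded Sg i.
rewrite -lerBlDr opprK addrC.
apply: (@le_trans _ _ (part f i b + g i b)).
  by rewrite lerD2r lerNl (le_trans _ (fM (Tagged B b)))// -normrN ler_norm.
apply: (@le_sup_range _ _ (fun b => part f i b + g i b) (M + N)) => b'.
by apply: lerD; apply: (le_trans (ler_norm _)); [exact: fM|exact: gN].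
Qed.

Let le_rho f c :
  (forall h, S h -> c <= sum_sup (fun i b => part f i b + h i b)) -> c <= rho f.
Proof.
move=> H; apply: lb_le_inf; last by move=> _ [h Sh <-]; exact: H.
by eexists; exists (fun _ _ => 0).
Qed.

(** Here [S] is used as a cone: competitors [h] for [f] and [k] for [g] give [h + k] for [f + g],
    and [t h] for [t f]. *)
Let sublinear_rho : sublinear rho.
Proof.
have bd f h i : S h -> exists M, forall b, part f i b + h i b <= M.
  move=> Sh; have [M fM] := bounded_part f i; have [N gN] := S_bounded Sh i.
  by exists (M + N) => b; apply: lerD; apply: (le_trans (ler_norm _));
    [exact: fM|exact: gN].
split=> [f g|t f t0].
  rewrite -lerBlDr; apply: le_rho => h Sh.
  rewrite lerBlDr -lerBlDl; apply: le_rho => k Sk; rewrite lerBlDl.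
  rewrite (le_trans (rho_le _ (SD Sh Sk)))// /sum_sup -big_split/=.
  apply: ler_sum => i _; apply: (sup_range_le (b0 i)) => b.
  rewrite /part/= addrACA.
  have [M hM] := bd f h i Sh; have [N kN] := bd g k i Sk.
  exact: lerD (le_sup_range b hM) (le_sup_range b kN).
rewrite -ler_pdivrMl//; apply: le_rho => h Sh; rewrite ler_pdivrMl//.
rewrite (le_trans (rho_le _ (SZ t0 Sh)))// /sum_sup mulr_sumr.
apply: ler_sum => i _; apply: (sup_range_le (b0 i)) => b.
rewrite [part _ _ _](_ : _ = t * part f i b)// -mulrDr ler_pM2l//.
by have [M hM] := bd f h i Sh; exact: le_sup_range b hM.
Qed.

(** [L i] is the Hahn-Banach functional evaluated on extensions by zero from the [i]-th summand.
    Taking [h = 0] in [rho] bounds it by the supremum over [B i] plus zeros, which is the mean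
    property. *)
Lemma cone_separation : exists2 L : forall i, (B i -> R) -> R,
  (forall i, mean_on [set f | bounded_real f] (L i)) &
  forall h, S h -> 0 <= \sum_i L i (h i).
Proof.
have [L Llin Lrho] := hahn_banach sublinear_rho.
have L0 : L 0 = 0.
  by have := Llin (-1) 0 0; rewrite scaler0 addr0 mulN1r addNr.
have LD (f g : V) : L (f + g) = L f + L g
  by rewrite -[f in LHS]scale1r Llin mul1r.
have bounded0 : bounded_real (fun _ : {i & B i} => 0 : R).
  by exists 0 => z; rewrite normr0.
(* Unbounded functions are sent to the default 0; only bounded ones are ever evaluated. *)
pose pack f : V := insubd 0 (f : {i & B i} -> R^o).
have packE f : bounded_real f -> bf_val (pack f) = f.
  by move=> /asboolP fb; rewrite /pack -[bf_val _]/(val _) insubdK.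
pose at_ i (f : B i -> R) := dfwith (fun i (_ : B i) => 0 : R) i f.
have at_bd i (f : B i -> R) : bounded_real f ->
  forall j, bounded_real (at_ i f j).
  move=> fb j; rewrite /at_; case: dfwithP => // k ik.
  by exists 0 => b; rewrite normr0.
pose Li i (f : B i -> R) := L (pack (glue (at_ i f))).
have at_lin i (a : R) (f g : B i -> R) j b :
    at_ i (fun b => a * f b + g b) j b = a * at_ i f j b + at_ i g j b.
  rewrite /at_; have [e|ij] := eqVneq i j;
    last by rewrite !dfwithout// mulr0 addr0.
  by case: _ / e b => b; rewrite !dfwithin.
exists Li => [i|h Sh].
  split=> [a f g fb gb|f c fb fc].
    rewrite /Li -Llin; congr L; apply/val_inj/funext => -[j b].
    rewrite /= !packE; try by apply/bounded_glue/at_bd => //;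
      exact: bounded_real_lin.
    by rewrite /glue/= at_lin.
  rewrite (le_trans (Lrho _))// (le_trans (rho_le _ S0))//.
  (* The whole bound [c] is charged to the summand that carries [f]. *)
  pose d j := if j == i then c else 0.
  have -> : c = \sum_j d j.
    by rewrite (bigD1 i)//= /d eqxx big1 ?addr0// => j /negbTE->.
  apply: sum_sup_le => j b; rewrite addr0 /part packE;
    last exact/bounded_glue/at_bd.
  rewrite /glue/= /at_ /d eq_sym; have [e|ij] := eqVneq i j.
    by case: _ / e b => b; rewrite dfwithin.
  by rewrite dfwithout.
have hb := S_bounded Sh.
(* A glued tuple is the sum of the extensions by zero of its components. *)
have -> : \sum_i Li i (h i) = L (pack (glue h)).
  rewrite /Li -(big_morph L LD L0); congr L; apply/val_inj/funext => -[j b] /=.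
  rewrite packE; last exact: bounded_glue.
  have bfD (f g : V) : bf_val (f + g) (existT B j b) =
    (bf_val f (existT B j b) + bf_val g (existT B j b)) by [].
  have bf0 : bf_val (0 : V) (existT B j b) = 0 by [].
  rewrite (big_morph (fun f : V => bf_val f (existT B j b)) bfD bf0).
  rewrite (bigD1 j)//= big1 ?addr0 => [|i ij].
    by rewrite packE /glue/= ?/at_ ?dfwithin//; exact/bounded_glue/at_bd.
  by rewrite packE /glue/= ?/at_ ?dfwithout//; exact/bounded_glue/at_bd.
have : L (- pack (glue h)) <= 0.
  rewrite (le_trans (Lrho _))// (le_trans (rho_le _ Sh))//.
  rewrite (_ : 0 = \sum_(i : I) 0); last by rewrite big1.
  apply: sum_sup_le => j b; rewrite /part/= packE; last exact: bounded_glue.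
  by rewrite /glue/= addNr.
have -> : L (- pack (glue h)) = - L (pack (glue h)).
  by have := Llin (-1) (pack (glue h)) 0; rewrite L0 !addr0 scaleN1r mulN1r.
by rewrite oppr_le0.
Qed.

End cone_separation.

(** * The weak* compact dual ball *)

Section scalars.
Context (R : realType) (K : numFieldType) (s : scalar_field R K).

Lemma sreK (r : R) : sre s (sinj s r) = r. Proof. by case: s. Qed.

Lemma ler_sre (z w : K) : z <= w -> sre s z <= sre s w.
Proof. by case: s z w => // -[a b] [c d]; rewrite lecE => /andP[]. Qed.

Lemma ltr_sre (z w : K) : z < w -> sre s z < sre s w.
Proof. by case: s z w => // -[a b] [c d]; rewrite ltcE => /andP[]. Qed.

Lemma ltr_sinj (a b : R) : a < b -> sinj s a < sinj s b.
Proof. by case: s => // ab; rewrite ltcR. Qed.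

Lemma sinj0 : sinj s 0 = 0. Proof. by case: s. Qed.

Lemma sinj1 : sinj s 1 = 1. Proof. by case: s. Qed.

Lemma sinjM (a b : R) : sinj s (a * b) = sinj s a * sinj s b.
Proof. by case: s => //; rewrite -[LHS]/((a * b)%:C)%C rmorphM. Qed.

Lemma sinjB (a b : R) : sinj s (a - b) = sinj s a - sinj s b.
Proof. by case: s => //; rewrite -[LHS]/((a - b)%:C)%C rmorphB. Qed.

Lemma sinjD (a b : R) : sinj s (a + b) = sinj s a + sinj s b.
Proof. by case: s => //; rewrite -[LHS]/((a + b)%:C)%C rmorphD. Qed.

Lemma norm_sinj (a : R) : `|sinj s a| = sinj s `|a|.
Proof. by case: s => //; rewrite normc_def /= expr0n addr0 sqrtr_sqr. Qed.

Lemma ge0_sinj (z : K) : 0 <= z -> z = sinj s (sre s z).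
Proof. by case: s z => // -[a b]; rewrite lecE/= => /andP[/eqP ->]. Qed.

(** Describes discs of [K] as subsets of the image of a real square for both scalar fields; [i] is 0
    in the real case. *)
Lemma scalar_decomposition :
  exists i : K, forall z : K, exists a b : R,
    [/\ z = sinj s a + i * sinj s b, `|a| <= rnorm s (z : K^o)
      & `|b| <= rnorm s (z : K^o)].
Proof.
rewrite /rnorm; case: s.
  by exists 0 => z; exists z, 0; split; rewrite ?mul0r ?addr0 ?normr0 /=.
exists 'i%C => -[a b]; exists a, b; split.
- exact: complexE.
- by rewrite normc_def/= -sqrtr_sqr ler_wsqrtr// lerDl sqr_ge0.
- by rewrite normc_def/= -sqrtr_sqr ler_wsqrtr// lerDr sqr_ge0.
Qed.

Section norm.
Variable V : normedModType K.
Implicit Types v w : V.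

Lemma normE v : `|v| = sinj s (rnorm s v).
Proof. exact: ge0_sinj. Qed.

Lemma rnorm_ge0 v : 0 <= rnorm s v.
Proof. by rewrite -(sreK 0) sinj0 ler_sre. Qed.

Lemma ler_rnormD v w : rnorm s (v + w) <= rnorm s v + rnorm s w.
Proof. by rewrite -[leRHS]sreK sinjD -!normE ler_sre// ler_normD. Qed.

Lemma rnormN v : rnorm s (- v) = rnorm s v.
Proof. by rewrite /rnorm normrN. Qed.

Lemma rnormB v w : rnorm s (v - w) = rnorm s (w - v).
Proof. by rewrite -rnormN opprB. Qed.

Lemma rnormZ (a : K) v : rnorm s (a *: v) = rnorm s (a : K^o) * rnorm s v.
Proof.
by rewrite -[RHS]sreK sinjM /rnorm -!ge0_sinj// normrZ.
Qed.

Lemma rnorm_sinj (a : R) : rnorm s (sinj s a : K^o) = `|a|.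
Proof. by rewrite /rnorm norm_sinj sreK. Qed.

Lemma rnorm_eq0 v : rnorm s v = 0 -> v = 0.
Proof. by move=> v0; apply/normr0_eq0; rewrite normE v0 sinj0. Qed.

Lemma ler_dist_rnorm v w : `|rnorm s v - rnorm s w| <= rnorm s (v - w).
Proof.
have le (u z : V) : rnorm s u - rnorm s z <= rnorm s (u - z).
  by rewrite lerBlDr; have := ler_rnormD (u - z) z; rewrite subrK.
by rewrite ler_norml le andbT lerNl opprB rnormB le.
Qed.

(** Convergence in a normed space over [K] is tested with positive elements of [K]; these are
    exactly the images of the positive reals, so real thresholds suffice. *)
Lemma rnorm_cvg (T : Type) (F : set_system T) (FF : Filter F) (f : T -> V) v :
  f @ F --> v <-> forall e : R, 0 < e ->
    \forall t \near F, rnorm s (v - f t) < e.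
Proof.
split=> [/cvgrPdist_lt fv e e0|fv].
  have : 0 < sinj s e by rewrite -sinj0 ltr_sinj.
  by move=> /fv; apply: filterS => t /ltr_sre; rewrite sreK.
apply/cvgrPdist_lt => e e0; rewrite (ge0_sinj (ltW e0)).
have : 0 < sre s e by rewrite -(sreK 0) sinj0 ltr_sre.
by move=> /fv; apply: filterS => t /ltr_sinj; rewrite -normE.
Qed.

Lemma rnorm_continuous : continuous (@rnorm R K s V).
Proof.
move=> v; apply/cvgrPdist_lt => e e0.
have /(rnorm_cvg (nbhs_filter v)) /(_ e e0) : id @ v --> v by [].
by apply: filterS => w; exact: le_lt_trans (ler_dist_rnorm _ _).
Qed.

End norm.

Lemma sinj_continuous : continuous (sinj s : R -> K^o).
Proof.
move=> a; apply/rnorm_cvg => e e0.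
have /cvgrPdist_lt/(_ e e0) : id @ a --> a by [].
by apply: filterS => b; rewrite -sinjB rnorm_sinj.
Qed.

Lemma compact_disc (r : R) : compact [set z : K^o | rnorm s z <= r].
Proof.
have [i iP] := scalar_decomposition.
pose f (ab : R * R) : K^o := sinj s ab.1 + i * sinj s ab.2.
have cf : continuous f.
  move=> ab; apply: (@cvgD K K^o).
    by apply: (continuous_comp cvg_fst); exact: sinj_continuous.
  apply: (@cvgM K); first exact: cvg_cst.
  by apply: (continuous_comp cvg_snd); exact: sinj_continuous.
have sq : compact (`[-r, r] `*` `[-r, r] : set (R * R)).
  by apply: compact_setX; exact: segment_compact.
apply: (subclosed_compact (B := f @` (`[-r, r] `*` `[-r, r]))).
- apply: (@closed_comp _ _ (@rnorm R K s K^o) [set x | x <= r]).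
    by move=> z _; exact: rnorm_continuous.
  exact: closed_le.
- by apply: continuous_compact => //; exact: continuous_subspaceT.
- move=> z /= zr; have [a [b [zE az bz]]] := iP z.
  exists (a, b) => //; split; rewrite /= in_itv/= -ler_norml.
    exact: le_trans az zr.
  exact: le_trans bz zr.
Qed.

End scalars.
Section dual_ball_compact.
Context (R : realType) (K : numFieldType) (s : scalar_field R K).
Variable X : normedModType K.

(** Trades continuity and the operator norm for conditions on finitely many values of [f] at a time,
    each closed for pointwise convergence. Linearity is phrased as a norm being at most 0 to make it
    the preimage of a closed half-line. *)
Lemma dual_ballE : dual_ball s (X := X) =
  [set f |
    (forall (a : K) x y, rnorm s (f (a *: x + y) - (a * f x + f y) : K^o) <= 0)
    /\ forall x, rnorm s (f x : K^o) <= rnorm s x].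
Proof.
apply/seteqP; split=> f /=.
  move=> [lf cf nf]; split=> [a x y|x].
    by rewrite lf subrr rnorm0.
  have f0 : f 0 = 0.
    by have := lf (-1) 0 0; rewrite scaler0 addr0 scaleN1r addNr.
  have fZ (a : K) y : f (a *: y) = a * f y.
    by have := lf a y 0; rewrite addr0 f0 addr0.
  have [d d0 fd] : exists2 d : R, 0 < d &
      forall y, rnorm s y < d -> rnorm s (f y : K^o) < 1.
    have := (rnorm_cvg s (nbhs_filter (0 : X)) f (f 0 : K^o)).1 (cf 0) 1 ltr01.
    move=> /nbhs_norm0P[e /= e0 fe].
    exists (sre s e); first by rewrite -(sreK s 0) sinj0 ltr_sre.
    move=> y /(ltr_sinj s); rewrite -normE -ge0_sinj ?ltW// => /fe/=.
    by rewrite f0 sub0r rnormN.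
  (* Continuity is essential here: the supremum of an unbounded set is 0 by default, so
     [functional_norm f <= 1] alone bounds no value. The constant [2 / d] comes from shrinking the
     unit ball by [d / 2], into the region where [f] stays below 1. *)
  have nf_ub :
      has_ubound [set rnorm s (f x : K^o) | x in [set x : X | rnorm s x <= 1]].
    exists (2 / d) => _ [y /= y1 <-].
    have /fd : rnorm s (sinj s (d / 2) *: y) < d.
      rewrite rnormZ rnorm_sinj ger0_norm; last by rewrite divr_ge0 ?ltW.
      rewrite (@le_lt_trans _ _ (d / 2))//;
        last by rewrite ltr_pdivrMr// ltr_pMr ?ltr1n.
      by rewrite ler_piMr// divr_ge0 ?ltW.
    rewrite fZ -[_ * _]/(_ *: (f y : K^o)) rnormZ rnorm_sinj ger0_norm;
      last by rewrite divr_ge0 ?ltW.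
    by rewrite -ltr_pdivlMl ?divr_gt0// invf_div mulr1 => /ltW.
  have [x0|x0] := eqVneq (rnorm s x) 0.
    by rewrite (rnorm_eq0 x0) f0 !rnorm0.
  have xgt0 : 0 < rnorm s x by rewrite lt_neqAle eq_sym x0 rnorm_ge0.
  have absV : `|(rnorm s x)^-1| = (rnorm s x)^-1
    by rewrite ger0_norm// invr_ge0 ltW.
  have : rnorm s (f (sinj s (rnorm s x)^-1 *: x) : K^o) <= 1.
    rewrite (le_trans _ nf)//; apply: ub_le_sup => //.
    exists (sinj s (rnorm s x)^-1 *: x) => //=.
    by rewrite rnormZ rnorm_sinj absV mulVf.
  rewrite fZ -[_ * _]/(_ *: (f x : K^o)) rnormZ rnorm_sinj absV.
  by rewrite ler_pdivrMl// mulr1.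
move=> [lf nf].
have {}lf : linear (f : X -> K^o).
  move=> a x y; apply/eqP; rewrite -subr_eq0; apply/eqP/(@rnorm_eq0 _ _ s).
  by apply/eqP; rewrite eq_le lf rnorm_ge0.
split => //.
  move=> x; apply/(rnorm_cvg s) => e e0.
  have : id @ x --> x by [].
  move=> /(rnorm_cvg s)/(_ e e0); apply: filterS => y; apply: le_lt_trans.
  rewrite (le_trans _ (nf (x - y)))//.
  by have := lf (-1) y x; rewrite !scaleN1r ![- _ + _]addrC => ->.
apply: ge_sup; first by exists (rnorm s (f 0 : K^o)), 0; rewrite //= rnorm0.
by move=> _ [x /= x1 <-]; exact: le_trans (nf x) x1.
Qed.

Lemma continuous_lin_defect (T : topologicalType) (a : K) (f g h : T -> K^o) :
  continuous f -> continuous g -> continuous h ->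
  continuous (fun t => f t - (a * g t + h t) : K^o).
Proof.
move=> cf cg ch t; apply: (@cvgB K K^o); first exact: cf.
apply: (@cvgD K K^o); last exact: ch.
by apply: (@cvgM K); [exact: cvg_cst|exact: cg].
Qed.

(** Banach-Alaoglu: a product of compact discs is compact by Tychonoff, and linearity cuts out a
    closed subset of it. *)
Lemma compact_dual_ball : compact (dual_ball s (X := X)).
Proof.
pose disc (x : X) := [set z : K | rnorm s (z : K^o) <= rnorm s x].
pose D := [set f : {ptws X -> K} | forall x, disc x (f x)].
have cD : compact D.
  apply: (@tychonoff X (fun=> K) disc).
  by move=> x; exact: (@compact_disc _ _ s (rnorm s x)).
have -> : dual_ball s (X := X) =
    D `&` \bigcap_(u in [set: K * X * X])
      [set f | rnorm s (f (u.1.1 *: u.1.2 + u.2) -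
                        (u.1.1 * f u.1.2 + f u.2) : K^o) <= 0].
  rewrite dual_ballE; apply/seteqP; split=> f /= [f1 f2].
    by split => // -[[a x] y] _; exact: f1.
  by split => // a x y; exact: (f2 (a, x, y)).
apply: compact_closedI => //; apply: closed_bigI => -[[a x] y] _ /=.
apply: (@closed_comp {ptws X -> K} R
  (fun f => rnorm s (f (a *: x + y) - (a * f x + f y) : K^o)) [set r | r <= 0]);
  last exact: closed_le.
have cts z : continuous (fun f : {ptws X -> K} => f z : K^o).
  by move=> f; exact: (@proj_continuous X (fun=> K) z).
have cF := continuous_lin_defect (a := a) (cts (a *: x + y)) (cts x) (cts y).
move=> f _; apply: (@continuous_comp _ _ _ _ (@rnorm R K s K^o) _ (cF f)).
exact: rnorm_continuous.
Qed.

(** A filter on the subtype is pushed forward along the inclusion; a cluster point in [A] is one for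
    the induced topology, whose open sets are traces. *)
Lemma compact_set_type (T : topologicalType) (A : set T) :
  compact A -> compact [set: A].
Proof.
move=> cA F FF _.
pose G : set_system T := [set C | F (set_val @^-1` C)].
have GF : ProperFilter G by exact: (fmap_proper_filter set_val FF).
have [|p [Ap clp]] := cA G GF.
  by rewrite /G/=; apply: filterS filterT => -[x xA] _; exact: set_mem xA.
exists (SigSub (mem_set Ap)); split => // C D FC.
rewrite nbhsE/= => -[_ [[W oW <-] Wp] WD].
have : G (set_val @` C) by rewrite /G/=; apply: filterS FC => x Cx; exists x.
have : nbhs p W by exact: open_nbhs_nbhs.
move=> /[swap] GC /(clp _ _ GC)[_ [[x Cx <-] Wx]].
by exists x; split => //; exact: WD.
Qed.

Lemma compact_wball : compact [set: wball s X].
Proof. exact: compact_set_type compact_dual_ball. Qed.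

Lemma hausdorff_wball : hausdorff_space (wball s X).
Proof.
move=> f g fg; apply/val_inj.
have hK : hausdorff_space {ptws X -> K}.
  by apply: hausdorff_product => x; exact: (@norm_hausdorff K K^o).
apply: hK => A B Af Bg.
have [x [Ax Bx]] := fg _ _ (@initial_continuous _ _ set_val f A Af)
  (@initial_continuous _ _ set_val g B Bg).
by exists (set_val x).
Qed.

End dual_ball_compact.

(** * The Riesz-Markov theorem *)

Section continuous_real.
Context (R : realType) (B : topologicalType).
Implicit Types f g : B -> R.

Lemma continuous_lin (a : R) f g : continuous f -> continuous g ->
  continuous (fun b => a * f b + g b).
Proof.
move=> cf cg b; apply: (@cvgD _ R^o); last exact: cg.
by apply: (@cvgM R); [exact: cvg_cst|exact: cf].
Qed.

Lemma continuousMr f g : continuous f -> continuous g ->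
  continuous (fun b => f b * g b).
Proof. by move=> cf cg b; apply: (@cvgM R); [exact: cf|exact: cg]. Qed.

Lemma continuous_cut (e : R) f : continuous f ->
  continuous (fun b => Num.max (f b - e) 0).
Proof.
move=> cf b; apply: (@continuous_max R B (fun b => f b - e) (fun=> 0)).
  by apply: (@cvgB _ R^o); [exact: cf|exact: cvg_cst].
exact: cvg_cst.
Qed.

Lemma continuous_gt_open f (e : R) : continuous f -> open [set b | e < f b].
Proof.
move=> cf; apply: (@open_comp _ _ f [set x | e < x]);
  first by move=> *; exact: cf.
exact: open_gt.
Qed.

Lemma continuous_ge_closed f (e : R) : continuous f ->
  closed [set b | e <= f b].
Proof.
move=> cf; apply: (@closed_comp _ _ f [set x | e <= x]);
  first by move=> *; exact: cf.
exact: closed_ge.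
Qed.

Lemma continuous_bounded f : compact [set: B] -> continuous f -> bounded_real f.
Proof.
move=> cB cf; have cfB : compact (range f).
  by apply: continuous_compact => //; exact: continuous_subspaceT.
have [M [_ HM]] := compact_bounded cfB.
exists (M + 1) => b; apply: (HM (M + 1)); first by rewrite ltrDl.
by exists b.
Qed.

End continuous_real.

Section mean_continuous.
Context (R : realType) (B : topologicalType) (L : (B -> R) -> R).
Hypothesis meanL : mean_on [set f | continuous f] L.
Implicit Types f g : B -> R.

Lemma mean_lin (a : R) f g : continuous f -> continuous g ->
  L (fun b => a * f b + g b) = a * L f + L g.
Proof. exact: meanL.1. Qed.

Lemma meanD f g : continuous f -> continuous g ->
  L (fun b => f b + g b) = L f + L g.
Proof.
move=> cf cg; rewrite -[L f]mul1r -mean_lin//.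
by congr L; apply/funext => b; rewrite mul1r.
Qed.

Lemma mean_le f (c : R) : continuous f -> (forall b, f b <= c) -> L f <= c.
Proof. exact: meanL.2. Qed.

Lemma le_mean f g : continuous f -> continuous g -> (forall b, f b <= g b) ->
  L f <= L g.
Proof.
move=> cf cg fg; rewrite -subr_le0 -mulN1r addrC -mean_lin//.
apply: mean_le => [|b]; first exact: continuous_lin.
by rewrite mulN1r addrC subr_le0.
Qed.

Lemma mean0 : L (fun=> 0) = 0.
Proof.
have c0 : continuous (fun _ : B => 0 : R) by move=> b; exact: cvg_cst.
have := @mean_lin (-1) _ _ c0 c0.
rewrite [X in _ = X + _]mulN1r addNr => L0; rewrite -[RHS]L0; congr L.
by apply/funext => b; rewrite mulr0 addr0.
Qed.

Lemma mean_cst (c : R) : L (fun=> c) = c.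
Proof.
have cc (x : R) : continuous (fun _ : B => x) by move=> b; exact: cvg_cst.
apply/eqP; rewrite eq_le mean_le//=.
have := @mean_lin (-1) _ _ (cc c) (cc 0).
by rewrite mean0 !addr0 !mulN1r -lerN2 => <-; exact: mean_le.
Qed.

End mean_continuous.

(** * The content of open sets attached to a mean *)

Section open_content.
Context (R : realType) (B : ptopologicalType) (L : (B -> R) -> R).
Hypothesis hB : hausdorff_space B.
Hypothesis cB : compact [set: B].
Hypothesis meanL : mean_on [set f | continuous f] L.
Implicit Types (f g : B -> R) (U V : set B).

(** The classical condition asks for a support inside [U]; here [f] merely vanishes off [U]. The
    truncation [max (f - e) 0] makes up for it: its support lies in the closed set where [f >= e],
    which is contained in [U], and its mean drops by at most [e]. *)
Definition below U : set (B -> R) :=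
  [set f : B -> R | [/\ continuous f, forall b, 0 <= f b, forall b, f b <= 1 &
               forall b, ~ U b -> f b = 0]].

Definition open_content U : R := sup [set L f | f in below U].

Let below0 U : below U (fun=> 0).
Proof. by split => // b; exact: cvg_cst. Qed.

Lemma mean_le_content U f : below U f -> L f <= open_content U.
Proof.
move=> Uf; apply: ub_le_sup; last by exists f.
by exists 1 => _ [g [cg _ g1 _] <-]; exact: mean_le.
Qed.

Lemma content_le U (c : R) : (forall f, below U f -> L f <= c) ->
  open_content U <= c.
Proof.
move=> H; apply: ge_sup; first by exists (L (fun=> 0)), (fun=> 0).
by move=> _ [f Uf <-]; exact: H.
Qed.

Lemma content_ge0 U : 0 <= open_content U.
Proof. by rewrite -(mean0 meanL); apply: mean_le_content. Qed.

Lemma le_content U V : U `<=` V -> open_content U <= open_content V.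
Proof.
move=> UV; apply: content_le => f [cf f0 f1 fU]; apply: mean_le_content.
by split => // b Vb; apply: fU => /UV.
Qed.

Lemma content_set0 : open_content set0 = 0.
Proof.
apply/eqP; rewrite eq_le content_ge0 andbT; apply: content_le => f [_ _ _ f0].
by rewrite (_ : f = fun=> 0) ?mean0//; apply/funext => b; exact: f0.
Qed.

Lemma content_setT : open_content [set: B] = 1.
Proof.
apply/eqP; rewrite eq_le; apply/andP; split.
  by apply: content_le => f [cf _ f1 _]; exact: mean_le.
rewrite -{1}(mean_cst meanL 1); apply: mean_le_content; split => // b.
  exact: cvg_cst.
by move=> /(_ I).
Qed.

Lemma cut_below U f (e : R) : 0 < e -> below U f ->
  below U (fun b => Num.max (f b - e) 0).
Proof.
move=> e0 [cf f0 f1 fU]; split; first exact: continuous_cut.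
- by move=> b; rewrite le_max lexx orbT.
- by move=> b; rewrite ge_max ler01 andbT lerBlDr (le_trans (f1 b))// lerDl ltW.
- by move=> b /fU ->; rewrite sub0r; apply/max_idPr; rewrite oppr_le0 ltW.
Qed.

Lemma mean_cut f (e : R) : continuous f ->
  L f <= L (fun b => Num.max (f b - e) 0) + e.
Proof.
move=> cf; rewrite -{2}(mean_cst meanL e) -meanD//; last 2 first.
- exact: continuous_cut.
- by move=> b; exact: cvg_cst.
apply: le_mean => // [b|b]; last by rewrite -lerBlDr le_max lexx.
by apply: (@cvgD _ R^o); [exact: continuous_cut|exact: cvg_cst].
Qed.

(* A Urysohn function splits [max (f - e) 0] into one function supported in [U]
   and one supported in [V]. *)
Lemma content_setU U V : open U -> open V ->
  open_content (U `|` V) <= open_content U + open_content V.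
Proof.
move=> oU oV; apply: content_le => f UVf; apply/ler_addgt0Pr => e e0.
have [cf f0 f1 fUV] := UVf.
rewrite (le_trans (mean_cut e cf))// lerD2r.
set f' := fun b => _.
have [cf' f'0 f'1 f'UV] : below (U `|` V) f' by exact: cut_below.
have /normal_separatorP sep := compact_normal hB cB.
have cU : closed (~` U) by rewrite closedC.
(* Off [V] the truncated function can be nonzero only on this set. It is disjoint from the
   complement of [U] because [f] vanishes off the union. *)
have cV : closed ([set b | e <= f b] `\` V).
  by rewrite setDE; apply: closedI;
    [exact: continuous_ge_closed|rewrite closedC].
have UV0 : ~` U `&` ([set b | e <= f b] `\` V) = set0.
  rewrite -subset0 => b [/= nU [fe nV]].
  have fb0 : f b = 0 by apply: fUV => -[].
  by move: fe; rewrite /= fb0 leNgt e0.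
have := sep R _ _ cU cV UV0.
move=> /(@uniform_separatorP _ R)[u [cu u01 uU uV]].
have u_ge0 b : 0 <= u b.
  by have /u01 : range u (u b) by []; rewrite /= in_itv/= => /andP[].
have u_le1 b : u b <= 1.
  by have /u01 : range u (u b) by []; rewrite /= in_itv/= => /andP[].
have u0 b : ~ U b -> u b = 0 by move=> Ub; apply: uU; exists b.
have fu : f' = fun b => f' b * u b + f' b * (1 - u b).
  by apply/funext => b; rewrite -mulrDr addrC subrK mulr1.
have c1u : continuous (fun b => 1 - u b).
  by move=> b; apply: (@cvgB _ R^o); [exact: cvg_cst|exact: cu].
rewrite {1}fu meanD//; try exact: continuousMr.
apply: lerD; apply: mean_le_content; split.
- exact: continuousMr.
- by move=> b; rewrite mulr_ge0.
- by move=> b; rewrite mulr_ile1.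
- by move=> b /u0 ->; rewrite mulr0.
- exact: continuousMr.
- by move=> b; rewrite mulr_ge0// subr_ge0.
- by move=> b; rewrite mulr_ile1 ?subr_ge0// lerBlDr lerDl.
- move=> b nV; have [fe|fe] := leP e (f b).
    by have -> : u b = 1; [apply: uV; exists b|rewrite subrr mulr0].
  by rewrite /f' (max_idPr _) ?mul0r// subr_le0 ltW.
Qed.

Lemma content_bigsetU (U : (set B)^nat) n : (forall i, open (U i)) ->
  open_content (\big[setU/set0]_(i < n) U i) <= \sum_(i < n) open_content (U i).
Proof.
move=> oU; elim: n => [|n IH]; first by rewrite !big_ord0 content_set0.
rewrite !big_ord_recr/= (le_trans (content_setU _ _))//; last by rewrite lerD2r.
by rewrite -bigcup_mkord; apply: bigcup_open => i _; exact: oU.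
Qed.

(** The truncation of [f] vanishes off the compact set where [f >= e], and finitely many [U i] cover
    that set. *)
Lemma mean_le_sum_content (U : (set B)^nat) f (e : R) : 0 < e ->
  (forall i, open (U i)) -> below (\bigcup_i U i) f ->
  exists n, L f <= \sum_(i < n) open_content (U i) + e.
Proof.
move=> e0 oU Uf; have [cf f0 f1 fU] := Uf.
have cA : compact [set b | e <= f b].
  by apply: subclosed_compact cB _ => //; exact: continuous_ge_closed.
have := cA; rewrite compact_cover.
move=> /(_ nat setT U (fun i _ => oU i))[|D _ DU].
  move=> b /= fb; apply: contrapT => nUb; move: fb; rewrite fU ?leNgt ?e0//.
have [n Dn] : exists n, forall i, i \in D -> (i < n)%N.
  exists (\max_(i <- D) i).+1 => i iD; rewrite ltnS.
  exact: (@leq_bigmax_seq _ _ predT id).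
exists n; rewrite (le_trans (mean_cut e cf))// lerD2r.
rewrite (le_trans _ (content_bigsetU n oU))//.
have [cf' f'0 f'1 _] := cut_below e0 Uf.
apply: mean_le_content; split => // b nb.
rewrite (max_idPr _)// subr_le0 leNgt; apply/negP => /ltW /DU[i /Dn ni Uib].
by apply: nb; rewrite -bigcup_mkord; exists i.
Qed.

(** A function living where [f < e] and the truncation of [f] at [e] are never nonzero together, so
    their sum is still at most 1 and competes in the content of [V]. *)
Lemma content_disjoint U V f (e : R) : 0 < e -> U `<=` V -> below U f ->
  L f + open_content (V `&` [set b | f b < e]) <= open_content V + e.
Proof.
move=> e0 UV Uf; have [cf f0 f1 fU] := Uf.
rewrite -lerBrDl; apply: content_le => g [cg g0 g1 gW].
rewrite lerBrDl (le_trans (lerD (mean_cut e cf) (lexx _)))// addrAC lerD2r.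
have [cf' f'0 f'1 f'U] := cut_below e0 Uf.
rewrite -meanD//; apply: mean_le_content; split.
- by move=> b; apply: (@cvgD _ R^o); [exact: cf'|exact: cg].
- by move=> b; rewrite addr_ge0.
- move=> b; have [fe|fe] := ltP (f b) e.
    by rewrite (max_idPr _) ?add0r// subr_le0 ltW.
  by rewrite (gW b) ?addr0// => -[_]; rewrite /= ltNge fe.
- by move=> b nV; rewrite f'U ?gW ?addr0// => [[]//|/UV].
Qed.

End open_content.

(** * The outer measure and its restriction to Borel sets *)

Section riesz.
Context (R : realType) (B : ptopologicalType) (L : (B -> R) -> R).
Hypothesis hB : hausdorff_space B.
Hypothesis cB : compact [set: B].
Hypothesis meanL : mean_on [set f | continuous f] L.

Definition outer_content (E : set B) : R :=
  inf [set open_content L U | U in [set U | open U /\ E `<=` U]].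

Lemma outer_content_le (E U : set B) : open U -> E `<=` U ->
  outer_content E <= open_content L U.
Proof.
move=> oU EU; apply: ge_inf; last by exists U.
by exists 0 => _ [V _ <-]; exact: content_ge0.
Qed.

Lemma le_outer_content (E : set B) (c : R) :
  (forall U, open U -> E `<=` U -> c <= open_content L U) ->
  c <= outer_content E.
Proof.
move=> H; apply: lb_le_inf; last by move=> _ [U [oU EU] <-]; exact: H.
by exists (open_content L setT), setT => //; split => //; exact: openT.
Qed.

Lemma outer_content_ge0 (E : set B) : 0 <= outer_content E.
Proof. by apply: le_outer_content => U _ _; exact: content_ge0. Qed.

Lemma outer_content_open (U : set B) : open U ->
  outer_content U = open_content L U.
Proof.
move=> oU; apply/eqP; rewrite eq_le outer_content_le//=.
by apply: le_outer_content => V _; exact: le_content.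
Qed.

Lemma outer_content_approx (E : set B) (e : R) : 0 < e ->
  exists U, [/\ open U, E `<=` U & open_content L U < outer_content E + e].
Proof.
move=> e0; apply: contrapT => H.
have : outer_content E + e <= outer_content E.
  apply: le_outer_content => U oU EU; rewrite leNgt; apply/negP => UE.
  by apply: H; exists U.
by rewrite gerDl leNgt e0.
Qed.

Lemma outer_content_sigma_subadditive (A : set B) (F : (set B)^nat) :
  subset_sigma_subadditive (fun E => (outer_content E)%:E) A F.
Proof.
move=> AF; apply/lee_addgt0Pr => e e0.
have e2 : 0 < e / 2 by rewrite divr_gt0.
(* Half of [e] is spread geometrically over the open approximations of the [F k]; the other half
   pays for truncating [f]. *)
have ek k : 0 < e / 2 * 2^-1 ^+ k.+1 by rewrite mulr_gt0// exprn_gt0// invr_gt0.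
have /choice[U UP] k := outer_content_approx (F k) (ek k).
have oU k : open (U k) by have [] := UP k.
have FU k : F k `<=` U k by have [] := UP k.
have cU k : open_content L (U k) < outer_content (F k) + e / 2 * 2^-1 ^+ k.+1.
  by have [] := UP k.
have geo n : \sum_(k < n) (e / 2 * 2^-1 ^+ k.+1) = e / 2 * (1 - 2^-1 ^+ n).
  elim: n => [|n IH]; first by rewrite big_ord0 expr0 subrr mulr0.
  by rewrite big_ord_recr/= IH exprS; field.
have : ((outer_content A)%:E <= (open_content L (\bigcup_k U k))%:E)%E.
  rewrite lee_fin; apply: outer_content_le;
    first by apply: bigcup_open => k _; exact: oU.
  by apply: subset_trans AF _; exact: subset_bigcup.
move=> /le_trans; apply.
have ser n : ((\sum_(k < n) outer_content (F k))%:E <=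
    \sum_(k <oo) (outer_content (F k))%:E)%E.
  rewrite -sumEFin -(big_mkord xpredT (fun k => (outer_content (F k))%:E)).
  by apply: nneseries_lim_ge => k _ _; rewrite lee_fin outer_content_ge0.
have key f : below (\bigcup_k U k) f ->
    ((L f)%:E <= \sum_(k <oo) (outer_content (F k))%:E + e%:E)%E.
  move=> Uf; have [n] := mean_le_sum_content hB cB meanL e2 oU Uf.
  move=> Lf; apply: le_trans (leeD2r e%:E (ser n)).
  rewrite -EFinD lee_fin (le_trans Lf)//.
  have : \sum_(k < n) open_content L (U k) <=
      \sum_(k < n) outer_content (F k) + e / 2 * (1 - 2^-1 ^+ n).
    rewrite -geo -big_split/=; apply: ler_sum => k _; exact/ltW/cU.
  have : e / 2 * (1 - 2^-1 ^+ n) <= e / 2.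
    by rewrite ler_piMr ?ltW// gerBl exprn_ge0// invr_ge0.
  lra.
(* An infinite series is a trivial bound; a finite one is a real number, with which the supremum
   defining the content can be compared. *)
have [|] := leP (+oo)%E (\sum_(k <oo) (outer_content (F k))%:E)%E.
  by rewrite leye_eq => /eqP ->; rewrite leey.
have : (0 <= \sum_(k <oo) (outer_content (F k))%:E)%E.
  by apply: nneseries_ge0 => k _ _; rewrite lee_fin outer_content_ge0.
move: key; case: (\sum_(k <oo) _)%E => // r key _ _.
by rewrite -EFinD lee_fin; apply: content_le => f /key; rewrite -EFinD lee_fin.
Qed.

(** For an open [V] containing [E] and [f] below [V] and [U], the part of [V] where [f < e] is open
    and contains [E] minus [U], because [f] vanishes off [U]. Thus [content_disjoint] splits the
    content of [V] up to [e]. *)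
Lemma outer_content_caratheodory (U E : set B) : open U ->
  outer_content (E `&` U) + outer_content (E `&` ~` U) <= outer_content E.
Proof.
move=> oU; apply: le_outer_content => V oV EV.
apply: (@le_trans _ _ (open_content L (V `&` U) + outer_content (E `&` ~` U))).
  by rewrite lerD2r outer_content_le//; [exact: openI|exact: setSI].
rewrite -lerBrDr; apply: content_le => f VUf; have [cf f0 f1 fVU] := VUf.
rewrite lerBrDr; apply/ler_addgt0Pr => e e0.
have VUV : V `&` U `<=` V by move=> b [].
rewrite (le_trans _ (content_disjoint meanL e0 VUV VUf))//.
rewrite lerD2l outer_content_le//.
  apply: openI => //; rewrite [X in open X](_ : _ = ~` [set b | e <= f b]).
    by rewrite openC; exact: continuous_ge_closed.
  by apply/seteqP; split=> b /=; rewrite ltNge => /negP.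
move=> b [Eb nUb]; split; first exact: EV.
by rewrite /= fVU// => -[].
Qed.

Lemma riesz_outer_measure : exists mu : {outer_measure set B -> \bar R},
  forall E, mu E = (outer_content E)%:E.
Proof.
pose m (E : set B) := (outer_content E)%:E.
have m0 : m set0 = 0%E.
  by rewrite /m outer_content_open ?content_set0//; exact: open0.
have m_ge0 E : (0 <= m E)%E by rewrite lee_fin outer_content_ge0.
pose f := isSubsetOuterMeasure.Build R B m m0 m_ge0
  outer_content_sigma_subadditive.
pose mu : {outer_measure set B -> \bar R} := HB.pack m f.
by exists mu.
Qed.

Notation borel := (g_sigma_algebraType (@open B)).

(** Open sets are Caratheodory measurable, hence so are all Borel sets, and the outer measure is
    countably additive on them. *)
Lemma riesz_measure : exists mu : probability borel R,
  forall E : set B, mu E = (outer_content E)%:E.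
Proof.
have [mu muE] := riesz_outer_measure.
have sub : (measurable : set (set borel)) `<=` mu.-cara.-measurable.
  apply: smallest_sub.
    split; first exact: caratheodory_measurable_set0.
      by move=> A mA; rewrite setTD; exact: caratheodory_measurable_setC.
    by move=> A mA; exact: caratheodory_measurable_bigcup.
  move=> U oU; apply: le_caratheodory_measurable => E.
  by rewrite !muE -EFinD lee_fin outer_content_caratheodory.
pose m (E : set borel) := mu E.
have m0 : m set0 = 0%E by exact: outer_measure0.
have m_ge0 E : (0 <= m E)%E by exact: outer_measure_ge0.
have m_add : semi_sigma_additive m.
  move=> F mF tF mUF.
  apply: (@caratheodory_measure_sigma_additive _ _ mu) => //.
    by move=> i; exact: sub.
  exact: sub.
have m1 : m setT = 1%E.
  by rewrite /m muE outer_content_open ?content_setT//; exact: openT.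
pose f := isMeasure.Build _ borel R m m0 m_ge0 m_add.
pose mm : {measure set borel -> \bar R} := HB.pack m f.
pose g := Measure_isProbability.Build _ borel R mm m1.
pose P : probability borel R := HB.pack m f g.
by exists P.
Qed.

End riesz.

(** * Integrals of continuous functions *)

Section integral_continuous.
Context (R : realType) (B : ptopologicalType).
Notation borel := (g_sigma_algebraType (@open B)).
Variable mu : probability borel R.
Hypothesis cB : compact [set: B].
Implicit Types f g : B -> R.

Lemma open_borel (U : set B) : open U -> measurable (U : set borel).
Proof. by move=> oU; exact: sub_sigma_algebra. Qed.

Lemma continuous_measurable f : continuous f ->
  measurable_fun [set: borel] (f : borel -> R).
Proof.
move=> cf; apply: (measurability _ (RGenOpens.measurableE R)).
move=> _ [_ [a [b ->] <-]]; rewrite setTI; apply: open_borel.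
by move/continuousP : cf; apply; exact: interval_open.
Qed.

Lemma continuous_integrable f : continuous f ->
  mu.-integrable setT (EFin \o (f : borel -> R)).
Proof.
move=> cf; apply: measurable_bounded_integrable => //.
- exact: le_lt_trans (probability_le1 mu measurableT) (ltry 1).
- exact: continuous_measurable.
- have [M fM] := continuous_bounded cB cf.
  by exists M; split; rewrite ?num_real// => x Mx b _;
    exact: le_trans (fM b) (ltW Mx).
Qed.

(** Lets the lemmas on means apply to both sides of the representation formula, and to the integrals
    in the domination inequality. *)
Lemma integral_mean : mean_on [set f | continuous f]
  (fun f => \int[mu]_b (f : borel -> R) b).
Proof.
split=> [a f g cf cg|f c cf fc].
  have ca : continuous (fun b => a * f b).
    by move=> b; apply: (@cvgM R); [exact: cvg_cst|exact: cf].
  rewrite (@RintegralD _ borel R mu setT (fun b => a * f b) g) ?RintegralZl//;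
    exact: continuous_integrable.
have -> : c = \int[mu]_b (fun _ : borel => c) b.
  by rewrite Rintegral_cst// (congr1 fine (probability_setT mu)) mulr1.
apply: le_Rintegral => //; apply: continuous_integrable => // b; exact: cvg_cst.
Qed.

Lemma integral_ge_open f (U : set B) (c : R) : continuous f -> open U ->
  0 <= c ->
  (forall b, 0 <= f b) -> (forall b, U b -> c <= f b) ->
  c * fine (mu U) <= \int[mu]_b (f : borel -> R) b.
Proof.
move=> cf oU c0 f0 fU.
rewrite -lee_fin /Rintegral fineK; last first.
  by apply: integrable_fin_num => //; exact: continuous_integrable.
rewrite EFinM fineK ?fin_num_measure//; last exact: open_borel.
have mU := open_borel oU.
rewrite -integral_cst//.
have mf := continuous_measurable cf.
apply: (@le_trans _ _ (\int[mu]_(b in (U : set borel)) (f b)%:E)%E).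
  apply: ge0_le_integral => //=.
  by apply/measurable_EFinP; exact: measurable_funS mf.
apply: ge0_subset_integral => //=.
  exact/measurable_EFinP.
by move=> b _; rewrite lee_fin.
Qed.

End integral_continuous.

Section riesz_markov.
Context (R : realType) (B : ptopologicalType) (L : (B -> R) -> R).
Hypothesis hB : hausdorff_space B.
Hypothesis cB : compact [set: B].
Hypothesis meanL : mean_on [set f | continuous f] L.
Notation borel := (g_sigma_algebraType (@open B)).
Variable mu : probability borel R.
Hypothesis muE : forall E : set B, mu E = (outer_content L E)%:E.
Implicit Types f g : B -> R.

(** Outer regularity is built into [outer_content]. Inner regularity is outer regularity of the
    complement: closed sets are compact here, and the total mass is 1. *)
Lemma riesz_regular (A : set borel) : measurable A ->
    mu A = ereal_inf [set mu U | U in [set U : set B | open U /\ A `<=` U]]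
    /\ mu A =
       ereal_sup [set mu F | F in [set F : set B | compact F /\ F `<=` A]].
Proof.
move=> mA; split; apply/eqP; rewrite eq_le; apply/andP; split.
- apply: le_ereal_inf_tmp => _ [U [oU AU] <-].
  by rewrite !muE lee_fin (outer_content_open meanL oU) outer_content_le.
- apply/lee_addgt0Pr => e e0.
  have [U [oU AU]] := outer_content_approx L A e0.
  rewrite -(outer_content_open meanL oU) => Ue.
  apply: (@le_trans _ _ (mu U)); first by apply: ereal_inf_lbound; exists U.
  by rewrite !muE -EFinD lee_fin ltW.
- apply/lee_addgt0Pr => e e0.
  have [U [oU AU]] := outer_content_approx L (~` A) e0.
  rewrite -(outer_content_open meanL oU) => Ue.
  have cF : compact (~` U) by apply: subclosed_compact cB _; rewrite ?closedC.
  apply: (@le_trans _ _ (mu (~` U) + e%:E)%E); last first.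
    rewrite leeD2r//; apply: ereal_sup_ubound; exists (~` U) => //; split => //.
    by rewrite -[A]setCK; exact: subsetC.
  have := probability_setC mu mA; have := probability_setC mu (open_borel oU).
  rewrite !muE -!EFinD => -[->] [HA]; rewrite lee_fin.
  by move: Ue; rewrite HA; lra.
- apply: ge_ereal_sup => _ [F [cF FA] <-].
  rewrite !muE lee_fin; apply: le_outer_content => U oU AU.
  by apply: outer_content_le => //; exact: subset_trans AU.
Qed.

Let I f := \int[mu]_b (f : borel -> R) b.

(* Peeling off the layer [min f e] lowers the range of [f] by [e]. *)
Lemma riesz_layers (e : R) n f : 0 < e -> continuous f ->
  (forall b, 0 <= f b) ->
  (forall b, f b <= e *+ n) ->
  L f <= I f + e * fine (mu [set b | 0 < f b]).
Proof.
move=> e0; elim: n f => [|n IH] f cf f0 fn.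
  have -> : f = fun=> 0.
    by apply/funext => b; apply/eqP; rewrite eq_le f0 andbT (le_trans (fn b)).
  rewrite (mean0 meanL) addr_ge0//.
    by apply: Rintegral_ge0.
  by rewrite mulr_ge0 ?fine_ge0// ltW.
pose g b := Num.max (f b - e) 0.
pose h b := f b - g b.
have cg : continuous g by exact: continuous_cut.
have ch : continuous h by move=> b; apply: (@cvgB _ R^o); [exact: cf|exact: cg].
have fE : f = fun b => h b + g b by apply/funext => b; rewrite subrK.
have oU g' : continuous g' -> open [set b | 0 < g' b]
  by exact: continuous_gt_open.
have meanI := integral_mean mu cB.
have -> : L f = L h + L g by rewrite -meanD// -fE.
have -> : I f = I h + I g by rewrite /I -(meanD meanI)// -fE.
have hE b : h b = Num.min (f b) e.
  rewrite /h /g; have [fe|fe] := leP (f b) e.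
    by rewrite (max_idPr _) ?subr0// subr_le0.
  by rewrite (max_idPl _) ?subKr// subr_ge0 ltW.
have Lg : L g <= I g + e * fine (mu [set b | 0 < g b]).
  apply: IH => //.
    by move=> b; rewrite le_max lexx orbT.
  move=> b; rewrite ge_max; apply/andP; split; last exact: mulrn_wge0 (ltW e0).
  by rewrite lerBlDr -mulrSr fn.
(* The layer [h] equals [e] wherever [g > 0], so its integral absorbs the error term of the
   induction hypothesis; the errors telescope instead of adding up. *)
have Ih : e * fine (mu [set b | 0 < g b]) <= I h.
  apply: integral_ge_open => //; first exact: oU.
  - exact: ltW.
  - by move=> b; rewrite hE le_min f0 ltW.
  - by move=> b; rewrite /= lt_max ltxx orbF subr_gt0 hE le_min lexx andbT =>
      /ltW.
(* [h / e] is at most 1 and vanishes where [f] does, so it competes in the content of the open set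
   where [f > 0]. *)
have Lh : L h <= e * fine (mu [set b | 0 < f b]).
  rewrite -ler_pdivrMl// muE/= outer_content_open//; last exact: oU.
  rewrite -[_ * L h]addr0 -[X in _ + X](mean0 meanL) -mean_lin//; last first.
    by move=> b; exact: cvg_cst.
  apply: mean_le_content => //; split.
  - by apply: continuous_lin => // b; exact: cvg_cst.
  - by move=> b; rewrite addr0 mulr_ge0 ?invr_ge0 ?(ltW e0)// hE le_min f0 ltW.
  - by move=> b; rewrite addr0 ler_pdivrMl// mulr1 hE ge_min lexx orbT.
  - move=> b nf; have fb0 : f b = 0.
      by apply/eqP; rewrite eq_le f0 andbT leNgt; apply/negP.
    by rewrite hE fb0 (min_idPl (ltW e0)) mulr0 addr0.
lra.
Qed.

(** One inequality is enough, applied to [f] and to [- f]. Adding a constant, which both means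
    preserve, makes the function nonnegative; the error left by layers of height [e] is at most [e]
    since the total mass is 1. *)
Lemma riesz_integral f : continuous f -> L f = I f.
Proof.
have meanI := integral_mean mu cB.
have cst_cts (c : R) : continuous (fun _ : B => c) by move=> b; exact: cvg_cst.
suff le g : continuous g -> L g <= I g.
  move=> cf; apply/eqP; rewrite eq_le le//=.
  have := le _ (continuous_lin (a := -1) cf (cst_cts 0)).
  rewrite (mean_lin meanL)// /I (mean_lin meanI)// (mean0 meanL) (mean0 meanI).
  by rewrite !addr0 !mulN1r lerN2.
move=> cg; have [M gM] := continuous_bounded cB cg.
have gM' b : 0 <= 1 * g b + M.
  by have := gM b; rewrite ler_norml mul1r => /andP[]; lra.
have M0 : 0 <= M by exact: le_trans (gM point).
have cgM := continuous_lin (a := 1) cg (cst_cts M).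
suff : L (fun b => 1 * g b + M) <= I (fun b => 1 * g b + M).
  rewrite (mean_lin meanL)// /I (mean_lin meanI)//
    (mean_cst meanL) (mean_cst meanI).
  by rewrite lerD2r !mul1r.
apply/ler_addgt0Pr => e e0.
have [n Mn] : exists n, (M + M) / e <= n%:R.
  exists (Num.trunc ((M + M) / e)).+1.
  by rewrite ltW// truncnS_gt.
rewrite (le_trans (@riesz_layers e n _ e0 cgM gM' _))//.
  move=> b; rewrite mul1r -mulr_natr -ler_pdivrMl// mulrC (le_trans _ Mn)//.
  rewrite ler_pM2r ?invr_gt0// lerD2r.
  by have := gM b; rewrite ler_norml => /andP[].
rewrite lerD2l; apply: (ler_piMr (ltW e0)).
rewrite muE/= outer_content_open//; last first.
  exact: continuous_gt_open.
by rewrite -(content_setT meanL) le_content.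
Qed.

End riesz_markov.

Theorem riesz_markov (R : realType) (B : ptopologicalType) (L : (B -> R) -> R) :
  hausdorff_space B -> compact [set: B] -> mean_on [set f | continuous f] L ->
  exists2 mu : probability (g_sigma_algebraType (@open B)) R,
    forall A : set (g_sigma_algebraType (@open B)), measurable A ->
      mu A = ereal_inf [set mu U | U in [set U : set B | open U /\ A `<=` U]]
      /\ mu A =
       ereal_sup [set mu F | F in [set F : set B | compact F /\ F `<=` A]] &
    forall f, continuous f ->
      L f = \int[mu]_b (f : g_sigma_algebraType (@open B) -> R) b.
Proof.
move=> hB cB meanL; have [mu muE] := riesz_measure hB cB meanL.
exists mu; first by move=> A mA; exact: (riesz_regular cB meanL muE mA).
by move=> f cf; exact: (riesz_integral cB meanL muE cf).
Qed.

(** * Pietsch domination *)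

Section powers.
Context (R : realType).

Lemma powR_prod (I : Type) (r : seq I) (F : I -> R) (p : R) :
  (forall i, 0 <= F i) ->
  (\prod_(i <- r) F i) `^ p = \prod_(i <- r) F i `^ p.
Proof.
move=> F0; elim: r => [|i r IH]; first by rewrite !big_nil powR1.
by rewrite !big_cons powRM ?IH// prodr_ge0.
Qed.

Lemma le_powR (p x y : R) : 0 <= p -> 0 <= x -> x <= y -> x `^ p <= y `^ p.
Proof.
by move=> p0 x0 xy; rewrite ge0_ler_powR// nnegrE// (le_trans x0).
Qed.

Lemma powRK (p x : R) : p != 0 -> 0 <= x -> (x `^ p) `^ p^-1 = x.
Proof. by move=> p0 x0; rewrite -powRrM divff// powRr1. Qed.

Lemma powRVK (p x : R) : p != 0 -> 0 <= x -> (x `^ p^-1) `^ p = x.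
Proof. by move=> p0 x0; rewrite -powRrM mulVf// powRr1. Qed.

Lemma powR_sum (I : Type) (r : seq I) (w : I -> R) (x : R) : 0 < x ->
  x `^ (\sum_(i <- r) w i) = \prod_(i <- r) x `^ w i.
Proof.
move=> x0; elim: r => [|i r IH]; first by rewrite !big_nil powRr0.
by rewrite !big_cons powRD ?IH// (gt_eqF x0) implybT.
Qed.

Lemma continuous_powR_comp (B : topologicalType) (f : B -> R) (p : R) : 0 < p ->
  continuous f -> (forall b, 0 <= f b) -> continuous (fun b => f b `^ p).
Proof.
move=> p0 cf f0 b.
have [fb0|fb0] := eqVneq (f b) 0.
  apply/cvgrPdist_lt => e e0.
  have e1 : 0 < e `^ p^-1 by exact: powR_gt0.
  have /cvgrPdist_lt/(_ _ e1) := cf b.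
  apply: filterS => t; rewrite fb0 powR0 ?gt_eqF// !sub0r !normrN.
  rewrite !ger0_norm ?powR_ge0// => ft.
  by rewrite -(powRVK (lt0r_neq0 p0) (ltW e0)) gt0_ltr_powR// nnegrE// powR_ge0.
have fb : 0 < f b by rewrite lt_neqAle eq_sym fb0 f0.
apply: (@continuous_comp _ _ _ f (fun x : R => x `^ p)); first exact: cf.
apply: differentiable_continuous; apply/derivable1_diffP.
by apply: derivable_powR; rewrite in_itv/= fb.
Qed.

(** The tangent to [ln] at the weighted mean [M] gives [ln (x i) <= x i / M - 1 + ln M]; in the
    weighted sum the first two terms cancel. A zero factor is treated apart, as it has no
    logarithm. *)
Lemma weighted_am_gm (I : finType) (w x : I -> R) :
  (forall i, 0 < w i) -> \sum_i w i = 1 -> (forall i, 0 <= x i) ->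
  \prod_i x i `^ w i <= \sum_i w i * x i.
Proof.
move=> w0 w1 x0.
have sum_ge0 : 0 <= \sum_i w i * x i
  by apply: sumr_ge0 => i _; rewrite mulr_ge0// ltW.
have [[i xi]|/forallNP xn0] := pselect (exists i, x i = 0).
  by rewrite (bigD1 i)//= xi powR0 ?gt_eqF// mul0r.
have xgt0 i : 0 < x i by rewrite lt_neqAle x0 eq_sym andbT; apply/eqP/xn0.
have [i0 _|I0] := pickP (fun i : I => true); last first.
  by move: w1; rewrite big1 => [/esym/eqP|i _]; [rewrite oner_eq0|have := I0 i].
set M := \sum_i w i * x i.
have M0 : 0 < M.
  rewrite /M (bigD1 i0)//= ltr_pwDl ?mulr_gt0//.
  by apply: sumr_ge0 => i _; rewrite mulr_ge0// ltW.
have -> : \prod_i x i `^ w i = expR (\sum_i w i * ln (x i)).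
  by rewrite expR_sum; apply: eq_bigr => i _; rewrite /powR gt_eqF.
rewrite -[leRHS]lnK ?posrE// ler_expR.
apply: (@le_trans _ _ (\sum_i w i * (x i / M - 1 + ln M))).
  apply: ler_sum => i _; apply: (ler_wpM2l (ltW (w0 i))).
  rewrite -lerBlDr -ln_div ?posrE//.
  have := @le_ln1Dx _ (x i / M - 1); rewrite [1 + _]addrC subrK; apply.
  by rewrite ltrBrDr addNr divr_gt0.
under eq_bigr do rewrite mulrDr mulrBr mulr1 mulrA.
rewrite big_split/= sumrB -!mulr_suml w1 mul1r -/M divff ?gt_eqF// subrr add0r.
exact: lexx.
Qed.

(** Hoelder's inequality for several factors: after division of each [a k i] by its total [A i], the
    weighted mean inequality is applied for every [k], and the resulting bounds sum to 1. *)
Lemma sum_prod_powR_le (I : finType) (w : I -> R) (n : nat)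
    (a : 'I_n -> I -> R) :
  (forall i, 0 < w i) -> \sum_i w i = 1 -> (forall k i, 0 <= a k i) ->
  \sum_(k < n) \prod_i a k i `^ w i <= \prod_i (\sum_(k < n) a k i) `^ w i.
Proof.
move=> w0 w1 a0; pose A i := \sum_(k < n) a k i.
have A0 i : 0 <= A i by exact: sumr_ge0.
have [[i Ai]|/forallNP An0] := pselect (exists i, A i = 0).
  have ai k : a k i = 0.
    by have /psumr_eq0P/(_ Ai) := (fun k (_ : true) => a0 k i); apply.
  rewrite big1 => [|k _]; first by apply: prodr_ge0 => j _; exact: powR_ge0.
  by rewrite (bigD1 i)//= ai powR0 ?gt_eqF// mul0r.
have Agt0 i : 0 < A i by rewrite lt_neqAle A0 eq_sym andbT; apply/eqP/An0.
have P0 : 0 < \prod_i A i `^ w i by apply: prodr_gt0 => i _; exact: powR_gt0.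
rewrite -[leRHS]mul1r -ler_pdivrMr// mulr_suml.
apply: (@le_trans _ _ (\sum_(k < n) \sum_i w i * (a k i / A i))).
  apply: ler_sum => k _; rewrite ler_pdivrMr//.
  have -> : \prod_i a k i `^ w i =
      (\prod_i (a k i / A i) `^ w i) * \prod_i A i `^ w i.
    rewrite -big_split; apply: eq_bigr => i _ /=.
    by rewrite -powRM ?divr_ge0// divfK// gt_eqF.
  by rewrite ler_pM2r//; apply: weighted_am_gm => // i; rewrite divr_ge0.
rewrite exchange_big/= -w1; apply: ler_sum => i _.
by rewrite -mulr_sumr -mulr_suml -/(A i) divff ?mulr1// gt_eqF.
Qed.

End powers.

Lemma continuous_sum (R : realType) (B : topologicalType) (I : Type)
    (r : seq I) (F : I -> B -> R) :
  (forall i, continuous (F i)) -> continuous (fun b => \sum_(i <- r) F i b).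
Proof.
move=> cF; elim: r => [|i r IH].
  by under [X in continuous X]eq_fun do rewrite big_nil; move=> b;
    exact: cvg_cst.
under [X in continuous X]eq_fun do rewrite big_cons.
by move=> b; apply: (@cvgD _ R^o); [exact: cF|exact: IH].
Qed.

Lemma continuous_prod (R : realType) (B : topologicalType) (I : Type)
    (r : seq I) (F : I -> B -> R) :
  (forall i, continuous (F i)) -> continuous (fun b => \prod_(i <- r) F i b).
Proof.
move=> cF; elim: r => [|i r IH].
  by under [X in continuous X]eq_fun do rewrite big_nil; move=> b;
    exact: cvg_cst.
under [X in continuous X]eq_fun do rewrite big_cons.
exact: continuousMr.
Qed.

Lemma mean_sum (R : realType) (B : topologicalType) (L : (B -> R) -> R)
    (I : Type) (r : seq I) (F : I -> B -> R) :
  mean_on [set f | continuous f] L -> (forall i, continuous (F i)) ->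
  L (fun b => \sum_(i <- r) F i b) = \sum_(i <- r) L (F i).
Proof.
move=> meanL cF; elim: r => [|i r IH].
  by under [X in L X]eq_fun do rewrite big_nil; rewrite big_nil (mean0 meanL).
under [X in L X]eq_fun do rewrite big_cons.
by rewrite big_cons (meanD meanL)// ?IH//; exact: continuous_sum.
Qed.

(** * Domination for families homogeneous under dilations *)

Section domination.
Context (R : realType) (m : nat) (p : R) (q : 'I_m -> R).
Hypothesis p_gt0 : 0 < p.
Hypothesis q_gt0 : forall j, 0 < q j.
Hypothesis pq : p^-1 = \sum_(j < m) (q j)^-1.
Context (X : 'I_m -> Type) (B : 'I_m -> ptopologicalType).
Hypothesis hB : forall j, hausdorff_space (B j).
Hypothesis cB : forall j, compact [set: B j].
Variable psi : forall j, X j -> B j -> R.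
Hypothesis psi_cts : forall j v, continuous (psi (j := j) v).
Hypothesis psi_ge0 : forall j v b, 0 <= psi (j := j) v b.
Variable dil : forall j, R -> X j -> X j.
Hypothesis psi_dil : forall j (t : R) v b, 0 < t ->
  psi (dil (j := j) t v) b = t * psi v b.
Variable N : (forall j, X j) -> R.
Hypothesis N_ge0 : forall x, 0 <= N x.
Hypothesis N_dil : forall (t : 'I_m -> R) x, (forall j, 0 < t j) ->
  N (fun j => dil (t j) (x j)) = (\prod_j t j) * N x.

Notation borel j := (g_sigma_algebraType (@open (B j))).

Let w j := p / q j.

Let w_gt0 j : 0 < w j. Proof. exact: divr_gt0. Qed.

Let w_sum : \sum_j w j = 1.
Proof. by rewrite -mulr_sumr -pq divff ?gt_eqF. Qed.

Let a j (v : X j) (b : B j) : R := psi v b `^ q j.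
Arguments a : clear implicits.

Let a_ge0 j v b : 0 <= a j v b. Proof. exact: powR_ge0. Qed.

Let a_cts j v : continuous (a j v).
Proof. exact: continuous_powR_comp (q_gt0 j) (@psi_cts j v) (psi_ge0 v). Qed.

Let sum_cts j (I : Type) (r : seq I) (v : I -> X j) :
  continuous (fun b => \sum_(i <- r) a j (v i) b).
Proof. by apply: continuous_sum => i; exact: a_cts. Qed.

Let sup_norm_root j (n : nat) (x : 'I_n -> X j) : R :=
  sup_norm (fun b => (\sum_(i < n) psi (x i) b `^ q j) `^ (q j)^-1).

Let sup_norm_rootP j (n : nat) (x : 'I_n -> X j) b :
  (\sum_(i < n) a j (x i) b) `^ (q j)^-1 <= sup_norm_root x.
Proof.
have [M SM] := continuous_bounded (@cB j) (@sum_cts j _ (index_enum 'I_n) x).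
rewrite /sup_norm_root /sup_norm (le_trans (ler_norm _))//.
apply: (@le_sup_range _ _ (fun b =>
  `|(\sum_(i < n) psi (x i) b `^ q j) `^ (q j)^-1|) (M `^ (q j)^-1)) => b'.
have Sb' : 0 <= \sum_(i < n) a j (x i) b' by exact: sumr_ge0.
have SM' : \sum_(i < n) a j (x i) b' <= M
  by exact: le_trans (ler_norm _) (SM b').
rewrite ger0_norm ?powR_ge0//; apply: le_powR => //.
by rewrite invr_ge0 ltW.
Qed.

Let sup_norm_root_ge0 j (n : nat) (x : 'I_n -> X j) : 0 <= sup_norm_root x.
Proof. exact: le_trans (powR_ge0 _ _) (sup_norm_rootP x point). Qed.

Definition summing_with (C : R) :=
  forall (n : nat) (x : 'I_n -> forall j, X j),
    (\sum_(i < n) N (x i) `^ p) `^ p^-1 <=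
    C * \prod_(j < m) sup_norm (fun b =>
      (\sum_(i < n) psi (x i j) b `^ q j) `^ (q j)^-1).

Definition dominated_by (C : R) (mu : forall j, probability (borel j) R) :=
  forall x, N x <=
    C * \prod_(j < m) (\int[mu j]_b (psi (x j) b `^ q j)) `^ (q j)^-1.

Lemma dominated_summing (C : R) mu : 0 < C -> dominated_by C mu ->
  summing_with C.
Proof.
move=> C0 dom n x; pose I j v := \int[mu j]_b (a j v b).
have I_ge0 j v : 0 <= I j v by exact: Rintegral_ge0.
have P0 : 0 <= \prod_j sup_norm_root (x ^~ j) by exact: prodr_ge0.
have CP0 : 0 <= C * \prod_j sup_norm_root (x ^~ j) by rewrite mulr_ge0// ltW.
rewrite -[leRHS](powRK (lt0r_neq0 p_gt0))//.
apply: le_powR; first by rewrite invr_ge0 ltW.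
  by apply: sumr_ge0 => i _; exact: powR_ge0.
have step i : N (x i) `^ p <= C `^ p * \prod_j I j (x i j) `^ w j.
  have -> : C `^ p * \prod_j I j (x i j) `^ w j =
      (C * \prod_j I j (x i j) `^ (q j)^-1) `^ p.
    rewrite powRM ?(ltW C0)//; last by apply: prodr_ge0 => j _; exact: powR_ge0.
    rewrite powR_prod => [|j]; last exact: powR_ge0.
    by congr (_ * _); apply: eq_bigr => j _; rewrite -powRrM mulrC.
  by apply: le_powR; [exact: ltW|exact: N_ge0|exact: dom].
apply: (le_trans (ler_sum _ (fun i _ => step i))).
rewrite -mulr_sumr powRM ?(ltW C0)// powR_prod; last first.
  by move=> j; exact: (sup_norm_root_ge0 (x ^~ j)).
rewrite (ler_wpM2l (powR_ge0 _ _))//.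
apply: (le_trans (@sum_prod_powR_le _ _ w n (fun i j => I j (x i j))
  w_gt0 w_sum _)) => //.
apply: ler_prod => j _; rewrite powR_ge0/=.
have -> : sup_norm_root (x ^~ j) `^ p = (sup_norm_root (x ^~ j) `^ q j) `^ w j.
  by rewrite -powRrM mulrCA divff ?mulr1// gt_eqF.
have meanI := integral_mean (mu j) (@cB j).
apply: le_powR; [exact: ltW|exact: sumr_ge0|].
(* The sum of integrals is the integral of the sum, which a probability measure keeps below any
   uniform bound. *)
rewrite -(mean_sum (index_enum 'I_n) meanI (fun i => @a_cts j (x i j))).
apply: (mean_le meanI) => [|b]; first exact: sum_cts.
have S0 : 0 <= \sum_(i < n) a j (x i j) b by exact: sumr_ge0.
rewrite -[leLHS](powRVK (lt0r_neq0 (q_gt0 j)))//.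
apply: le_powR; [exact: ltW|exact: powR_ge0|].
exact: (sup_norm_rootP (x ^~ j)).
Qed.

Let tau (s : seq (forall j, X j)) : R := \sum_(x <- s) N x `^ p.

Let supa (s : seq (forall j, X j)) j : R :=
  sup (range (fun b => \sum_(x <- s) a j (x j) b)).

Let supaP s j b : \sum_(x <- s) a j (x j) b <= supa s j.
Proof.
have [M SM] := continuous_bounded (@cB j)
  (@sum_cts j _ s (fun x => x j)).
apply: (@le_sup_range _ _ (fun b => \sum_(x <- s) a j (x j) b) M) => b'.
exact: le_trans (ler_norm _) (SM b').
Qed.

Let supa_ge0 s j : 0 <= supa s j.
Proof. by rewrite (le_trans _ (supaP s point))// sumr_ge0. Qed.

Let summing_seq (C : R) : 0 < C -> summing_with C -> forall s,
  tau s <= C `^ p * \sum_j w j * supa s j.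
Proof.
move=> C0 sumC s.
have tau0 : 0 <= tau s by apply: sumr_ge0 => x _; exact: powR_ge0.
apply: (@le_trans _ _ (C `^ p * \prod_j supa s j `^ w j)); last first.
  by rewrite (ler_wpM2l (powR_ge0 _ _))//; exact: weighted_am_gm.
have -> : C `^ p * \prod_j supa s j `^ w j =
    (C * \prod_j supa s j `^ (q j)^-1) `^ p.
  rewrite powRM ?(ltW C0)//; last by apply: prodr_ge0 => j _; exact: powR_ge0.
  rewrite powR_prod => [|j]; last exact: powR_ge0.
  by congr (_ * _); apply: eq_bigr => j _; rewrite -powRrM mulrC.
rewrite -[leLHS](powRVK (lt0r_neq0 p_gt0))//.
have R0 : 0 <= C * \prod_j supa s j `^ (q j)^-1.
  by rewrite mulr_ge0 ?(ltW C0)//; apply: prodr_ge0 => j _; exact: powR_ge0.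
apply: le_powR; [exact: ltW|exact: powR_ge0|].
rewrite /tau (big_tnth _ _ s) (le_trans (sumC _ (tnth (in_tuple s))))//.
rewrite (ler_wpM2l (ltW C0))//; apply: ler_prod => j _; apply/andP; split.
  exact: (sup_norm_root_ge0 (fun i => tnth (in_tuple s) i j)).
apply: (sup_range_le point) => b; rewrite ger0_norm ?powR_ge0//.
have E : \sum_(x <- s) a j (x j) b =
    \sum_(i < size s) psi (tnth (in_tuple s) i j) b `^ q j.
  by rewrite (big_tnth _ _ s).
by rewrite -E; apply: le_powR; rewrite ?invr_ge0 ?(ltW (q_gt0 j)) ?sumr_ge0.
Qed.

Let a_dil j (t : R) (v : X j) (b : B j) : 0 < t ->
  a j (dil (t `^ (q j)^-1) v) b = t * a j v b.
Proof.
move=> t0; rewrite /a psi_dil ?powR_gt0// powRM ?powR_ge0//.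
by rewrite powRVK ?ltW// lt0r_neq0.
Qed.

Let N_dil_powR (t : R) x : 0 < t ->
  N (fun j => dil (t `^ (q j)^-1) (x j)) `^ p = t * N x `^ p.
Proof.
move=> t0; rewrite N_dil => [|j]; last exact: powR_gt0.
rewrite -powR_sum// -pq powRM ?powR_ge0//.
by rewrite powRVK ?ltW// lt0r_neq0.
Qed.

(** No coefficients are carried: concatenating sequences adds members, and dilating the entries
    multiplies a member by a positive scalar. *)
Let cone (C : R) : set (forall j, B j -> R) :=
  [set h | exists s, forall j b,
    h j b = w j * (C `^ p * \sum_(x <- s) a j (x j) b - tau s)].

Let exists_means (C : R) : 0 < C -> summing_with C ->
  exists2 L : forall j, (B j -> R) -> R,
    (forall j, mean_on [set f | continuous f] (L j)) &
    forall x, N x `^ p <= C `^ p * \sum_j w j * L j (a j (x j)).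
Proof.
move=> C0 sumC; have Cp0 : 0 < C `^ p by exact: powR_gt0.
have [h [s hs] j||h g [s hs] [s' gs]|t h t0 [s hs]|h [s hs]|L meanL LS] :=
    @cone_separation R 'I_m (fun j => B j) (fun j => point) (cone C).
- have : continuous
      (fun b : B j => w j * (C `^ p * \sum_(x <- s) a j (x j) b - tau s)).
    move=> b; apply: (@cvgM R); first exact: cvg_cst.
    apply: (@cvgB _ R^o); last exact: cvg_cst.
    by apply: (@cvgM R); [exact: cvg_cst|exact: sum_cts].
  move=> /(continuous_bounded (@cB j))[M HM].
  by exists M => b; rewrite hs.
- by exists [::] => j b; rewrite /tau !big_nil mulr0 subrr mulr0.
- exists (s ++ s') => j b; rewrite hs gs /tau !big_cat/=; ring.
- exists [seq (fun j => dil (t `^ (q j)^-1) (x j)) | x <- s] => j b.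
  rewrite hs /tau !big_map.
  under [X in _ = _ * (_ * X - _)]eq_bigr do rewrite a_dil//.
  under [X in _ = _ * (_ - X)]eq_bigr do rewrite N_dil_powR//.
  rewrite -!mulr_sumr; ring.
- apply: (@le_trans _ _ (\sum_j w j * (C `^ p * supa s j - tau s))).
    under eq_bigr do rewrite mulrBr.
    rewrite sumrB -mulr_suml w_sum mul1r subr_ge0.
    under eq_bigr do rewrite mulrCA.
    by rewrite -mulr_sumr; exact: summing_seq.
  apply: ler_sum => j _.
  have [M SM] := continuous_bounded (@cB j) (@sum_cts j _ s (fun x => x j)).
  have hM b : h j b <= w j * (C `^ p * M - tau s).
    rewrite hs (ler_wpM2l (ltW (w_gt0 j)))// lerD2r (ler_wpM2l (ltW Cp0))//.
    exact: le_trans (ler_norm _) (SM b).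
  (* Isolating [supa s j] on the left reduces the claim to a pointwise bound, read back as
     [h j b <= sup (range (h j))]. *)
  rewrite -ler_pdivlMl// lerBlDr -ler_pdivlMl//;
    apply: (sup_range_le point) => b.
  rewrite ler_pdivlMl// -lerBlDr ler_pdivlMl//.
  by rewrite -hs; exact: le_sup_range.
have meanL' j : mean_on [set f | continuous f] (L j).
  have [Ll Lc] := meanL j; split => [c f g cf cg|f c cf].
    by apply: Ll; exact: continuous_bounded.
  by apply: Lc; exact: continuous_bounded.
exists L => // x.
have /LS : cone C (fun j b => w j * (C `^ p * a j (x j) b - N x `^ p)).
  by exists [:: x] => j b; rewrite /tau !big_seq1.
suff -> : \sum_j L j (fun b => w j * (C `^ p * a j (x j) b - N x `^ p)) =
    C `^ p * \sum_j w j * L j (a j (x j)) - N x `^ p by rewrite subr_ge0.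
rewrite -[X in _ - X]mul1r -w_sum mulr_suml mulr_sumr -sumrB.
apply: eq_bigr => j _.
have -> : (fun b => w j * (C `^ p * a j (x j) b - N x `^ p)) =
    (fun b => (C `^ p * w j) * a j (x j) b + - (w j * N x `^ p)).
  by apply/funext => b; rewrite mulrBr mulrCA mulrA.
rewrite (mean_lin (meanL' j)); [|exact: a_cts|by move=> b; exact: cvg_cst].
by rewrite (mean_cst (meanL' j)) mulrA.
Qed.

Lemma summing_dominated (C : R) : 0 < C -> summing_with C ->
  exists2 mu : forall j, probability (borel j) R,
    forall j (A : set (borel j)), measurable A ->
      mu j A = ereal_inf
        [set mu j U | U in [set U : set (B j) | open U /\ A `<=` U]]
      /\ mu j A = ereal_sup
        [set mu j F | F in [set F : set (B j) | compact F /\ F `<=` A]] &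
    dominated_by C mu.
Proof.
move=> C0 sumC; have [L meanL NL] := exists_means C0 sumC.
have riesz j := cid2 (riesz_markov (@hB j) (@cB j) (meanL j)).
exists (fun j => s2val (riesz j)) => [j|x]; first exact: s2valP (riesz j).
pose I j := L j (a j (x j)).
have IE j : \int[s2val (riesz j)]_b (psi (x j) b `^ q j) = I j.
  exact/esym/(s2valP' (riesz j))/a_cts.
under eq_bigr do rewrite IE.
have I_ge0 j : 0 <= I j
  by rewrite -IE; apply: Rintegral_ge0 => b _; exact: powR_ge0.
have upper (c : 'I_m -> R) : (forall j, I j <= c j) -> (forall j, 0 < c j) ->
    N x <= C * \prod_j c j `^ (q j)^-1.
  move=> Ic c0.
  have P0 : 0 < \prod_j c j `^ (q j)^-1
    by apply: prodr_gt0 => j _; exact: powR_gt0.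
  rewrite -ler_pdivrMr//.
  have NE : N (fun j => dil ((c j)^-1 `^ (q j)^-1) (x j)) =
      N x / \prod_j c j `^ (q j)^-1.
    rewrite N_dil => [|j]; last by rewrite powR_gt0// invr_gt0.
    rewrite mulrC; congr (_ * _); rewrite -prodfV; apply: eq_bigr => j _.
    have := @powRM _ (c j) (c j)^-1 (q j)^-1 (ltW (c0 j)).
    rewrite divff ?gt_eqF// powR1 invr_ge0 => /(_ (ltW (c0 j))) H.
    by apply: (mulfI (lt0r_neq0 (powR_gt0 (q j)^-1 (c0 j))));
      rewrite -H divff// lt0r_neq0// powR_gt0.
  rewrite -NE -[leLHS](powRK (lt0r_neq0 p_gt0))//
    -[leRHS](powRK (lt0r_neq0 p_gt0) (ltW C0)).
  apply: le_powR; [by rewrite invr_ge0 ltW|exact: powR_ge0|].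
  apply: (le_trans (NL _)); rewrite -[leRHS]mulr1 (ler_wpM2l (powR_ge0 _ _))//.
  rewrite -w_sum; apply: ler_sum => j _.
  rewrite -[leRHS]mulr1 (ler_wpM2l (ltW (w_gt0 j)))//.
  have -> : a j (dil ((c j)^-1 `^ (q j)^-1) (x j)) =
      fun b => (c j)^-1 * a j (x j) b + 0.
    by apply/funext => b; rewrite addr0 a_dil ?invr_gt0.
  rewrite (mean_lin (meanL j)); [|exact: a_cts|by move=> b; exact: cvg_cst].
  by rewrite (mean0 (meanL j)) addr0 ler_pdivrMl// mulr1; exact: Ic.
(* The limit of [upper] as [c j] decreases to [I j]. The maximum keeps the base nonnegative for all
   real [e], and [e - 0] gives it the shape expected by [continuous_cut]. *)
pose F (e : R) := C * \prod_j (I j + Num.max (e - 0) 0) `^ (q j)^-1.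
have cF : continuous F.
  apply: continuousMr; first by move=> e; exact: cvg_cst.
  apply: continuous_prod => j; apply: continuous_powR_comp.
  - by rewrite invr_gt0.
  - move=> e; apply: (@cvgD _ R^o); first exact: cvg_cst.
    by apply: (@continuous_cut R R 0 id) => {}e; exact: cvg_id.
  - by move=> e; rewrite addr_ge0// le_max lexx orbT.
have -> : C * \prod_j I j `^ (q j)^-1 = F 0.
  by rewrite /F subr0 maxxx; under [X in _ = _ * X]eq_bigr do rewrite addr0.
rewrite leNgt; apply/negP => FN.
have /cvgrPdist_lt/(_ (N x - F 0)) := cF 0.
rewrite subr_gt0 => /(_ FN)/nbhs_normP[d /= d0 dF].
have d2 : 0 < d / 2 by exact: divr_gt0.
have := dF (d / 2); rewrite /ball_/= sub0r normrN (ger0_norm (ltW d2)).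
rewrite ltr_pdivrMr// ltr_pMr// ltr1n => /(_ isT).
rewrite ltr_norml => /andP[+ _].
have : N x <= F (d / 2).
  rewrite /F subr0 (max_idPl (ltW d2)); apply: upper => j.
    by rewrite lerDl ltW.
  by rewrite (lt_le_trans d2)// lerDr.
lra.
Qed.

End domination.

(** * Application to multilinear operators *)

Lemma multilinear_scale (R : realType) (K : numFieldType) (s : scalar_field R K)
    (m : nat) (X : 'I_m -> normedModType K) (Y : normedModType K)
    (T : (forall j, X j) -> Y) (c : 'I_m -> K) (x : forall j, X j) :
  multilinear T -> T (fun j => c j *: x j) = (\prod_j c j) *: T x.
Proof.
move=> linT.
(* Coordinates are scaled one at a time, those in [r] being done; absence of repetitions makes the
   product count each factor once. *)
suff scale (r : seq 'I_m) : uniq r ->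
    T (fun j => if j \in r then c j *: x j else x j) =
    (\prod_(j <- r) c j) *: T x.
  rewrite -scale ?index_enum_uniq//; congr T.
  by apply: functional_extensionality_dep => j; rewrite mem_index_enum.
elim: r => [_|k r IH /= /andP[kr ur]].
  by rewrite big_nil scale1r; congr T; apply: functional_extensionality_dep.
rewrite big_cons -scalerA -IH//.
set y := fun j => if j \in r then _ else _.
have yk : dfwith y k (y k) = y.
  by apply: functional_extensionality_dep => j; case: dfwithP.
have T0 : T (dfwith y k 0) = 0.
  by have := linT y k (-1) 0 0; rewrite scaler0 addr0 scaleN1r addNr.
have := linT y k (c k) (y k) 0; rewrite addr0 T0 addr0 yk => <-; congr T.
apply: functional_extensionality_dep => j; rewrite inE;
  have [e|jk] := eqVneq j k.
  by subst j; rewrite dfwithin /y (negbTE kr).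
by rewrite dfwithout 1?eq_sym.
Qed.

Theorem theorem3p6 (R : realType) (K : numFieldType) (s : scalar_field R K)
    (m : nat) (p : R) (q : 'I_m -> R)
    (p_ge1 : 1 <= p) (q_ge1 : forall j, 1 <= q j)
    (pq : p^-1 = \sum_(j < m) (q j)^-1)
    (X : 'I_m -> completeNormedModType K) (Y : completeNormedModType K)
    (Phi : forall j, Xhat s (X j) -> CB s (X j))
    (Phi_bounded : forall j, bounded_map (Phi j))
    (Phi_homogeneous : forall j, homogeneous (Phi j))
    (T : (forall j, X j) -> Y) (T_cont : continuous_multilinear T) :
  abstract_summing Phi p q T <->
  exists2 C : R, 0 < C &
    exists2 mu : forall j, probability (borel_wball s (X j)) R,
      forall j, regular_measure (mu j) &
      forall x : forall j, X j,
        rnorm s (T x) <=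
        C * \prod_(j < m)
          (\int[mu j]_b (rnorm s (Phi j (hat s (x j)) b : K^o) `^ q j))
            `^ (q j)^-1.
Proof.
have p_gt0 : 0 < p by exact: lt_le_trans p_ge1.
have q_gt0 j : 0 < q j by exact: lt_le_trans (q_ge1 j).
pose B j : ptopologicalType := wball s (X j).
pose psi j (v : X j) (b : B j) : R := rnorm s (Phi j (hat s v) b : K^o).
pose dil j (t : R) (v : X j) : X j := sinj s t *: v.
have psi_cts j v : continuous (psi j v).
  move=> b; apply: (@continuous_comp _ _ _ (Phi j (hat s v) : B j -> K^o)
    (@rnorm R K s K^o)).
    exact: (@cts_fun _ _ (Phi j (hat s v))).
  exact: rnorm_continuous.
have psi_ge0 j v b : 0 <= psi j v b by exact: rnorm_ge0.
have psi_dil j (t : R) v b : 0 < t -> psi j (dil j t v) b = t * psi j v b.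
  move=> t0; rewrite /psi (Phi_homogeneous j t _ (hat s v) t0) => [|b'].
    rewrite -[_ * _]/(_ *: (Phi j (hat s v) b : K^o)).
    by rewrite rnormZ rnorm_sinj gtr0_norm.
  (* Points of the ball are linear, so the bracket of [sinj s t *: v] is pointwise the multiple of
     that of [v], as homogeneity of [Phi j] requires. *)
  have [lin _ _] : dual_ball s (set_val b') by exact: set_mem (svalP b').
  have f0 : (set_val b' : X j -> K) 0 = 0.
    by have := lin (-1) 0 0; rewrite scaler0 addr0 scaleN1r addNr.
  by have := lin (sinj s t) v 0; rewrite addr0 f0 addr0.
have N_ge0 x : 0 <= rnorm s (T x) by exact: rnorm_ge0.
have N_dil (t : 'I_m -> R) x : (forall j, 0 < t j) ->
    rnorm s (T (fun j => dil j (t j) (x j))) = (\prod_j t j) * rnorm s (T x).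
  move=> t0; have [linT _] := T_cont.
  rewrite (multilinear_scale s (fun j => sinj s (t j)) x linT) rnormZ.
  rewrite -(big_morph (sinj s) (@sinjM _ _ s) (@sinj1 _ _ s)) rnorm_sinj.
  by rewrite ger0_norm// prodr_ge0// => j _; exact: ltW.
have hB j : hausdorff_space (B j) by exact: hausdorff_wball.
have cB j : compact [set: B j] by exact: compact_wball.
split=> [[C C0 sumC]|[C C0 [mu _ dom]]]; exists C => //.
  have [mu reg dom] := @summing_dominated R m p q p_gt0 q_gt0 pq X B hB cB psi
    psi_cts psi_ge0 dil psi_dil _ N_ge0 N_dil C C0 sumC.
  by exists mu.
exact: (@dominated_summing R m p q p_gt0 q_gt0 pq X B cB psi
    psi_cts psi_ge0 _ N_ge0 C mu C0 dom).
Qed.
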